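(* Assume that for each $1\le i\le m$, $\mathcal K_i:\mathbb R\times\mathbb R^n\to[0,\infty)$ is continuous with $\mathcal K_i(t,0)>0$ and $\int_{\mathbb R^n}\mathcal K_i(t,x)\,\mathrm dx=1$ for all $t\in\mathbb R$. Assume that $g\in C^{0,0,1}(\mathbb R\times\overline\Omega_0\times\mathbb R^m,\mathbb R^m)$, that $(\partial g_i(t,x,u)/\partial u_j)_{m\times m}$ is cooperative for all $x\in\overline\Omega_0$, $t\ge0$, $u\in\mathbb M$, and that for each $1\le i\le m$, $g_i(t,x,0)=0$ and $g_i(t,x,u)\le0$ whenever $u\in\mathbb M$ with $u_i=v_i$. Then for each $u_0\in\hat X_+^v$ the problem $$\frac{\partial u}{\partial t}=D\int_{\Omega_0}\mathcal K(t,x-y)u(t,y)\,\mathrm dy-Du+g(t,x,u),\quad t>0,\ x\in\overline\Omega_0,\qquad u(0,x)=u_0(x),\ x\in\overline\Omega_0,$$ admits a unique solution $u\in C(\mathbb R_+,\hat X_+^v)$ such that $\frac{\partial u}{\partial t}(t,x)$ exists for $t\ge0$ and $x\in\overline\Omega_0$.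
   Context: $m,n\ge1$ are integers; $\Omega_0\subset\mathbb R^n$ is a bounded, simply connected domain with smooth boundary; $D=\mathrm{diag}\{d_1,\dots,d_m\}$, $d_i>0$. $\mathcal K(t,x-y)u(t,y):=(\mathcal K_1(t,x-y)u_1(t,y),\dots,\mathcal K_m(t,x-y)u_m(t,y))^T$. Order in $\mathbb R^m$ is componentwise; $\|a\|_{\mathbb R^m}=\max_i|a_i|$. $v\in\mathrm{Int}(\mathbb R^m_+)$ is fixed and $\mathbb M=\{u\in\mathbb R^m:0\le u\le v\}$. A matrix is cooperative if its off-diagonal entries are nonnegative. $C^{0,0,1}$: continuous in $(t,x,u)$ with continuous first derivatives in $u$. $\hat X$: Banach space of bounded Lebesgue measurable functions $\overline\Omega_0\to\mathbb R^m$ (defined everywhere, not classes) with norm $\sup_{x\in\overline\Omega_0}\|\varphi(x)\|_{\mathbb R^m}$; $\hat X_+^v=\{\varphi\in\hat X:0\le\varphi(x)\le v,\ x\in\overline\Omega_0\}$, with the induced metric. $\mathbb R_+=[0,\infty)$. *)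

(* Defs.v *)
From HB Require Import structures.
From mathcomp Require Import all_boot all_order all_algebra.
From mathcomp Require Import all_classical all_reals all_analysis.

Set Implicit Arguments.
Unset Strict Implicit.
Unset Printing Implicit Defensive.

Import Order.TTheory GRing.Theory Num.Theory.
Import numFieldNormedType.Exports.

Local Open Scope classical_set_scope.
Local Open Scope ring_scope.

(* Lebesgue measure on R^n, as the Caratheodory restriction of the outer
   measure generated by volumes of boxes; its measurable sets are the Lebesgue
   (not only the Borel) measurable sets. *)
Section lebesgue_measure_rV.
Context {R : realType} {n : nat}.
Implicit Types (B : option ('rV[R]_n * 'rV[R]_n)) (A : set 'rV[R]_n).

(* [None] is the empty box: it makes finite covers available also when n = 0,
   where [box (Some _)] is never empty. *)
Definition box B : set 'rV[R]_n :=
  if B is Some (a, b) then [set x | forall i, a 0 i < x 0 i <= b 0 i] else set0.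

Definition box_volume B : \bar R :=
  if B is Some (a, b) then (\prod_i Num.max 0 (b 0 i - a 0 i))%:E else 0%E.

Definition box_cover A : set (nat -> option ('rV[R]_n * 'rV[R]_n)) :=
  [set F | A `<=` \bigcup_k box (F k)].

Definition lebesgue_outer A : \bar R :=
  ereal_inf [set (\sum_(k <oo) box_volume (F k))%E | F in box_cover A].

Local Open Scope ereal_scope.

Lemma box_volume_ge0 B : 0 <= box_volume B.
Proof.
case: B => [[a b]|] //=; rewrite lee_fin; apply: prodr_ge0 => i _.
by rewrite le_max lexx.
Qed.

Lemma lebesgue_outer_ge0 A : 0 <= lebesgue_outer A.
Proof.
apply: le_ereal_inf_tmp => x [F AF <-{x}].
by apply: nneseries_ge0 => k *; exact: box_volume_ge0.
Qed.

Lemma le_lebesgue_outer :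
  {homo lebesgue_outer : A B / A `<=` B >-> A <= B}.
Proof.
move=> A B AB; apply/ereal_inf_le_tmp => x [F BF <-{x}].
by exists F => //; exact: subset_trans AB BF.
Qed.

Lemma lebesgue_outer0 : lebesgue_outer set0 = 0.
Proof.
apply/eqP; rewrite eq_le lebesgue_outer_ge0 andbT.
apply: ereal_inf_lbound; exists (fun=> None) => //=.
by rewrite eseries0.
Qed.

Lemma lebesgue_outer_sigma_subadditive : sigma_subadditive lebesgue_outer.
Proof.
move=> A; have [[i ioo]|] := pselect (exists i, lebesgue_outer (A i) = +oo).
  rewrite (eseries_pinfty _ _ ioo) ?leey// => k _.
  by rewrite -ltNye (lt_le_trans _ (lebesgue_outer_ge0 _)).
rewrite -forallNE => Aoo.
suff add2e (e : {posnum R}) : lebesgue_outer (\bigcup_k A k) <=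
    \sum_(i <oo) lebesgue_outer (A i) + e%:num%:E.
  by apply/lee_addgt0Pr => _/posnumP[].
rewrite (le_trans _ (epsilon_trick _ _ _))//; last first.
  by move=> k; exact: lebesgue_outer_ge0.
pose P k (F : nat -> option ('rV[R]_n * 'rV[R]_n)) := box_cover (A k) F /\
  \sum_(j <oo) box_volume (F j) <=
    lebesgue_outer (A k) + (e%:num / (2 ^ k.+1)%:R)%:E.
have [G PG] : {G : nat -> nat -> option ('rV[R]_n * 'rV[R]_n) &
    forall k, P k (G k)}.
  apply: (@choice _ _ P) => k; rewrite /P /lebesgue_outer.
  set S := (X in ereal_inf X); move infS : (ereal_inf S) => iS.
  case: iS infS => [r Sr|Soo|Soo].
  - have en1 : (0 < e%:num / (2 ^ k.+1)%:R)%R by [].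
    have /(lb_ereal_inf_adherent en1) : ereal_inf S \is a fin_num by rewrite Sr.
    move=> [x [F AF muFx] xS].
    by exists F; split => //; rewrite muFx -Sr; exact/ltW.
  - by have := Aoo k; rewrite /lebesgue_outer -/S Soo.
  - suff : lbound S 0 by move/le_ereal_inf_tmp; rewrite Soo.
    move=> /= _ [F AF <-]; apply: nneseries_ge0 => j *.
    exact: box_volume_ge0.
have G_ge0 x : 0 <= (box_volume \o uncurry G) x by exact: box_volume_ge0.
apply: (@le_trans _ _ (\esum_(i in setT) (box_volume \o uncurry G) i)).
  rewrite /lebesgue_outer; apply: ereal_inf_lbound => /=.
  have /card_esym/ppcard_eqP[f] := card_nat2.
  exists (uncurry G \o f).
    move=> t [i _ /(PG i).1[j _ Gt]].
    by exists (f^-1%FUN (i, j)) => //=; rewrite invK ?inE.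
  rewrite -(esum_pred_image (box_volume \o uncurry G) _ xpredT)
    ?[fun=> _]set_true//.
  by rewrite image_eq.
rewrite (_ : esum _ _ = \sum_(i <oo) \sum_(j <oo ) box_volume (G i j)); last first.
  pose J : nat -> set (nat * nat) := fun i => [set (i, j) | j in setT].
  rewrite (_ : setT = \bigcup_k J k); last first.
    by rewrite predeqE => -[a b]; split => // _; exists a => //; exists b.
  rewrite esum_bigcupT /=; last 2 first.
    - apply/trivIsetP => i j _ _ ij.
      rewrite predeqE => -[k l] /=; split => //= -[] [_] _ [<-{k} _].
      by move=> [l' _] [] /esym/eqP; rewrite (negbTE ij).
    - by move=> k; exact: G_ge0.
  rewrite -(image_id [set: nat]) -fun_true esum_pred_image//; last first.
    by move=> k _; apply: esum_ge0 => p _; exact: G_ge0.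
  apply: eq_eseriesr => /= j _.
  rewrite -(esum_pred_image (box_volume \o uncurry G) (pair j) predT)//=;
    last 2 first.
    by move=> k _; exact: box_volume_ge0.
    by move=> ? ? _ _; exact: (@can_inj _ _ _ snd).
  by congr esum; rewrite predeqE => -[a b]; split; move=> [i _ <-]; exists i.
apply: lee_lim.
- apply: is_cvg_nneseries => k *.
  by apply: nneseries_ge0 => l *; exact: (G_ge0 (k, l)).
- apply: is_cvg_nneseries => k *; apply: adde_ge0 => //.
  exact: lebesgue_outer_ge0.
- by near=> k; apply: lee_sum => i _; exact: (PG i).2.
Unshelve. all: by end_near. Qed.

HB.instance Definition _ := isOuterMeasure.Build R 'rV[R]_n lebesgue_outer
  lebesgue_outer0 lebesgue_outer_ge0 le_lebesgue_outer
  lebesgue_outer_sigma_subadditive.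

End lebesgue_measure_rV.

(* R^n with the sigma-algebra of Lebesgue measurable sets. *)
Definition lebesgue_rV (R : realType) (n : nat) :=
  caratheodory_type (@lebesgue_outer R n).

HB.instance Definition _ (R : realType) (n : nat) :=
  Measurable.on (lebesgue_rV R n).

Definition lebesgue {R : realType} {n : nat} : set (lebesgue_rV R n) -> \bar R :=
  @lebesgue_outer R n.

HB.instance Definition _ (R : realType) (n : nat) :=
  isMeasure.Build _ (lebesgue_rV R n) R (@lebesgue R n)
    (@caratheodory_measure0 R _ (@lebesgue_outer R n))
    (@caratheodory_measure_ge0 R _ (@lebesgue_outer R n))
    (@caratheodory_measure_sigma_additive R _ (@lebesgue_outer R n)).

Section domains.
Context {R : realType} {n : nat}.
Implicit Types (A Om U : set 'rV[R]_n) (f : 'rV[R]_n -> R).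

Definition path_connected A :=
  forall x y, A x -> A y -> exists c : R -> 'rV[R]_n,
    [/\ {within `[0, 1], continuous c}, c 0 = x, c 1 = y &
        c @` `[0, 1] `<=` A].

Definition contractible_loops A :=
  forall c : R -> 'rV[R]_n, {within `[0, 1], continuous c} ->
    c @` `[0, 1] `<=` A -> c 0 = c 1 ->
  exists H : R * R -> 'rV[R]_n,
    [/\ {within `[0, 1] `*` `[0, 1], continuous H},
        H @` (`[0, 1] `*` `[0, 1]) `<=` A,
        (forall s, 0 <= s <= 1 -> H (0, s) = c s /\ H (1, s) = c 0) &
        forall r, 0 <= r <= 1 -> H (r, 0) = c 0 /\ H (r, 1) = c 0].

Definition simply_connected A := path_connected A /\ contractible_loops A.

Definition domain Om := [/\ open Om, Om !=set0 & connected Om].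

Definition unit_rV (j : 'I_n) : 'rV[R]_n := delta_mx 0 j.

Definition iter_partial (l : seq 'I_n) f : 'rV[R]_n -> R :=
  foldr (fun j h => 'D_(unit_rV j) h) f l.

(* C^oo on an open set: iterated partial derivatives of all orders exist and
   are continuous. *)
Definition smooth_on U f :=
  forall l x, U x -> {for x, continuous (iter_partial l f)} /\
    forall j, derivable (iter_partial l f) x (unit_rV j).

(* Near each boundary point, Om lies on one side of a smooth hypersurface,
   given by a local defining function with nonzero gradient. *)
Definition smooth_boundary Om :=
  forall p, (closure Om `\` Om°) p ->
  exists U rho, [/\ open_nbhs p U, smooth_on U rho,
    (exists j, 'D_(unit_rV j) rho p != 0) &
    Om `&` U = [set x | U x /\ rho x < 0]].

End domains.

Section order.
Context {R : realType} {m : nat}.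
Implicit Types (a b v : 'rV[R]_m).

Definition le_rV a b := forall i, a 0 i <= b 0 i.

Definition order_interval v : set 'rV[R]_m := [set a | le_rV 0 a /\ le_rV a v].

Definition cooperative (A : 'M[R]_m) := forall i j, i != j -> 0 <= A i j.

Definition partial_mx (f : 'rV[R]_m -> 'rV[R]_m) a : 'M[R]_m :=
  \matrix_(i, j) 'D_(unit_rV j) (fun b => f b 0 i) a.

End order.

Section problem.
Context {R : realType} {n m : nat}.
Variable Om : set 'rV[R]_n.
Implicit Types (phi : 'rV[R]_n -> 'rV[R]_m) (u : R -> 'rV[R]_n -> 'rV[R]_m).

(* C^{0,0,1}(R x closure Om x R^m, R^m) *)
Definition C001 (g : R -> 'rV[R]_n -> 'rV[R]_m -> 'rV[R]_m) :=
  let dom := [set p : R * 'rV[R]_n * 'rV[R]_m | closure Om p.1.2] in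
  [/\ {within dom, continuous (fun p => g p.1.1 p.1.2 p.2)},
      (forall t x a i j, closure Om x ->
         derivable (fun b => g t x b 0 i) a (unit_rV j)) &
      {within dom, continuous (fun p => partial_mx (g p.1.1 p.1.2) p.2)}].

(* Elements of the function spaces are represented by total functions, of
   which only the values on closure Om matter. *)
Definition hatX : set ('rV[R]_n -> 'rV[R]_m) :=
  [set phi : 'rV[R]_n -> 'rV[R]_m | [bounded phi x | x in closure Om] /\
    forall i, measurable_fun (closure Om : set (lebesgue_rV R n))
                (fun x : lebesgue_rV R n => phi x 0 i : measurableTypeR R)].

(* The norm on 'rV[R]_m is the max norm. *)
Definition hatX_norm phi : R := sup [set `|phi x| | x in closure Om].

Definition hatX_plus (v : 'rV[R]_m) : set ('rV[R]_n -> 'rV[R]_m) :=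
  [set phi : 'rV[R]_n -> 'rV[R]_m | hatX phi /\
    forall x, closure Om x -> order_interval v (phi x)].

Definition Rplus : set R := [set t | 0 <= t].

Definition C_Rplus_hatX (v : 'rV[R]_m) : set (R -> 'rV[R]_n -> 'rV[R]_m) :=
  [set u : R -> 'rV[R]_n -> 'rV[R]_m |
    (forall t, Rplus t -> hatX_plus v (u t)) /\
    forall t, Rplus t ->
      hatX_norm (fun x => u s x - u t x) @[s --> within Rplus (nbhs t)] --> 0].

Definition nonlocal_rhs (d : 'I_m -> R) (K : 'I_m -> R -> 'rV[R]_n -> R)
    (g : R -> 'rV[R]_n -> 'rV[R]_m -> 'rV[R]_m) u t x : 'rV[R]_m :=
  \row_i (d i * (\int[lebesgue]_(y in Om) (K i t (x - y) * u t y 0 i))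
          - d i * u t x 0 i + g t x (u t x) 0 i).

Definition solution (d : 'I_m -> R) (K : 'I_m -> R -> 'rV[R]_n -> R)
    (g : R -> 'rV[R]_n -> 'rV[R]_m -> 'rV[R]_m)
    (v : 'rV[R]_m) (u0 : 'rV[R]_n -> 'rV[R]_m) u :=
  [/\ C_Rplus_hatX v u,
      (forall x, closure Om x -> u 0 x = u0 x) &
      forall (t : R) x, 0 < t -> closure Om x ->
        is_derive t 1 (fun s => u s x) (nonlocal_rhs d K g u t x)].

(* One-sided at t = 0. *)
Definition derivable_Rplus (f : R -> 'rV[R]_m) (t : R) :=
  cvg ((s - t)^-1 *: (f s - f t) @[s --> within Rplus t^']).

End problem.

(* Main.v *)
Require Import Defs.
From HB Require Import structures.
From mathcomp Require Import all_boot all_order all_algebra.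
From mathcomp Require Import all_classical all_reals all_analysis.
From mathcomp Require Import measurable_realfun ring lra.

Import Order.TTheory GRing.Theory Num.Theory.
Import numFieldNormedType.Exports.

Local Open Scope classical_set_scope.
Local Open Scope ring_scope.

Set Implicit Arguments.
Unset Strict Implicit.
Unset Printing Implicit Defensive.

(** The problem is an ordinary differential equation [u' = F(t, u)] in the Banach
    space of bounded measurable functions on the closure of [Om], restricted to
    the closed set of functions with values in the order interval [[0, v]].  On
    this set and on bounded time intervals, [F] is bounded, Lipschitz in [u]
    ([rhs_lipschitz]) and equicontinuous in [t] ([rhs_equicontinuous]), because
    the kernels, [g] and its first derivatives in [u] are continuous, hence
    bounded and uniformly continuous on compact sets, and the kernels have mass
    at most [1].

    The heart of the matter is that the set is invariant.  Cooperativity together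
    with [g(t, x, 0) = 0] bounds [F_i] from below by [- L u_i]; the sign of [g_i]
    where [u_i = v_i], together with the mass of the kernels, bounds [F_i] from
    above by [L (v_i - u_i)] ([rhs_tangency]).  Hence the Euler step
    [u + h F(t, u)] remains in the set as soon as [h L <= 1]
    ([rhs_euler_invariant]).

    So Euler polygons never leave the set.  They are approximate solutions, a
    discrete Gronwall inequality ([approx_sol_dist]) makes them a uniform Cauchy
    sequence when the mesh goes to [0], and the limit satisfies the equation in
    difference form, uniformly in [x] ([strict_sol_exists]).  This yields
    continuity in the sup norm and differentiability in [t] at every [x]
    ([strict_sol_derivative]).  Conversely, by the mean value theorem every
    solution satisfies the equation in this uniform form
    ([classical_strict_sol]), and the same Gronwall inequality gives uniqueness.
    Nothing is integrated over time, so that measurability in [x] is needed only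
    for single Euler steps ([rhs_measurable]) and for uniform limits.

    Two facts on Lebesgue measure enter: functions that depend continuously on
    [x] and on a measurable vector are measurable
    ([measurable_fun_continuous_comp]), and reflections preserve the measure, so
    that [y |-> K(t, x - y)] has mass at most [1] on [Om] ([kernel_mass_le1]). *)

(** * Differential equations in the sup norm: Euler polygons *)
Section ode.
Context {R : realType} {X : Type}.
Variables (A : set X) (S : set (X -> R)) (F : R -> (X -> R) -> X -> R).
Implicit Types (phi psi : X -> R) (p q u w : R -> X -> R) (T L B e dl h : R).

Definition udist_le r phi psi := forall x, A x -> `|phi x - psi x| <= r.

Definition unif_closed :=
  forall phi, (forall e, 0 < e -> exists2 psi, S psi & udist_le e phi psi) -> S phi.

Definition lipschitz_upto T L := forall t phi psi r, 0 <= t <= T ->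
  S phi -> S psi -> udist_le r phi psi -> udist_le (L * r) (F t phi) (F t psi).

Definition bounded_upto T B := forall t phi x, 0 <= t <= T ->
  S phi -> A x -> `|F t phi x| <= B.

Definition equicontinuous_upto T := forall e, 0 < e -> exists2 dl, 0 < dl &
  forall s t phi, 0 <= s <= T -> 0 <= t <= T -> `|s - t| <= dl -> S phi ->
  udist_le e (F s phi) (F t phi).

(** A Nagumo-type condition: the explicit Euler step with a small enough step
    size stays in [S].  It replaces any extension of [F] outside of [S]. *)
Definition euler_invariant_upto T h0 := forall t phi h, 0 <= t <= T ->
  S phi -> 0 <= h <= h0 -> S (fun x => phi x + h * F t phi x).

(** An error of [e] per unit of time, on time steps shorter than [dl].  Euler
    polygons satisfy this with fixed [e] and [dl] as soon as their mesh is fine,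
    solutions satisfy it for every [e], and both are compared by one discrete
    Gronwall argument that never integrates in time. *)
Definition approx_sol T e dl p := forall s t, 0 <= s -> s <= t -> t <= T ->
  t - s <= dl -> forall x, A x ->
  `|p t x - p s x - (t - s) * F s (p s) x| <= e * (t - s).

(** The equation [u' = F t u] in difference form, uniformly over [A]: the limit
    of finer and finer approximate solutions. *)
Definition strict_sol T p :=
  forall e, 0 < e -> exists2 dl, 0 < dl & approx_sol T e dl p.

Lemma approx_sol_le T e dl dl' p : dl' <= dl ->
  approx_sol T e dl p -> approx_sol T e dl' p.
Proof. by move=> le sp s t s0 st tT tsd; apply: sp => //; exact: le_trans le. Qed.

(** Discrete Gronwall inequality on a grid of mesh [h <= dl] that ends at [t]:
    one step multiplies the distance of [p] and [q] by at most [1 + h L] and adds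
    the error [e h] of each of them. *)
Lemma approx_sol_dist T L e dl p q : 0 < L -> 0 <= e -> 0 < dl ->
  lipschitz_upto T L ->
  (forall t, 0 <= t <= T -> S (p t)) -> (forall t, 0 <= t <= T -> S (q t)) ->
  udist_le 0 (p 0) (q 0) -> approx_sol T e dl p -> approx_sol T e dl q ->
  forall t, 0 <= t <= T -> udist_le (2 * e / L * expR (L * T)) (p t) (q t).
Proof.
move=> L0 e0 dl0 lip Sp Sq pq0 ap aq t /andP[t0 tT].
have [N Ndl] : exists N : nat, t / dl < N.+1%:R.
  by exists (Num.truncn (t / dl)); apply: truncnS_gt.
pose h := t / N.+1%:R.
have h0 : 0 <= h by rewrite divr_ge0.
have hdl : h <= dl by rewrite ler_pdivrMr ?ltr0n// mulrC -ler_pdivrMr// ltW.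
have Nh : N.+1%:R * h = t by rewrite mulrC divfK// pnatr_eq0.
(* The bound is the solution of [r_(k+1) = (1 + h L) r_k + 2 e h], [r_0 = 0]. *)
have grid k : (k <= N.+1)%N ->
    udist_le (2 * e / L * ((1 + h * L) ^+ k - 1)) (p (k%:R * h)) (q (k%:R * h)).
  elim: k => [_|k IH kN] x Ax.
    by rewrite mul0r expr0 subrr mulr0; exact: pq0.
  have khT : k.+1%:R * h <= T.
    by rewrite (le_trans _ tT)// -[leRHS]Nh ler_wpM2r// ler_nat.
  have kh0 : 0 <= k%:R * h by rewrite mulr_ge0.
  have kk : k%:R * h <= k.+1%:R * h by rewrite ler_wpM2r// ler_nat.
  have kT : 0 <= k%:R * h <= T by rewrite kh0 (le_trans kk).
  have dk : k.+1%:R * h - k%:R * h = h by rewrite -natr1; ring.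
  have IHk := IH (ltnW kN).
  have := ap _ _ kh0 kk khT; rewrite dk => /(_ hdl _ Ax) apx.
  have := aq _ _ kh0 kk khT; rewrite dk => /(_ hdl _ Ax) aqx.
  have lx := lip _ _ _ _ kT (Sp _ kT) (Sq _ kT) IHk x Ax.
  have {}IHk := IHk x Ax.
  set pk' := p _ x in apx *; set qk' := q _ x in aqx *.
  set pk := p _ x in apx IHk; set qk := q _ x in aqx IHk.
  set Fp := F _ _ _ in apx lx; set Fq := F _ _ _ in aqx lx.
  have c0 : 0 <= h * L by rewrite mulr_ge0// ltW.
  have E : 2 * e / L * ((1 + h * L) ^+ k.+1 - 1) =
      (1 + h * L) * (2 * e / L * ((1 + h * L) ^+ k - 1)) + 2 * e * h.
    by rewrite exprS; field; rewrite gt_eqF.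
  rewrite E; set r := 2 * e / L * _ in IHk lx *.
  have hF : `|h * (Fp - Fq)| <= h * L * r.
    by rewrite normrM (ger0_norm h0) -mulrA ler_wpM2l.
  move: hF apx aqx IHk; rewrite !ler_norml => /andP[? ?] /andP[? ?] /andP[? ?] /andP[? ?].
  by apply/andP; split; lra.
move=> x Ax; rewrite -{1 2}Nh (le_trans (grid _ (leqnn _) x Ax))//.
have eL : 0 <= 2 * e / L by rewrite divr_ge0 ?mulr_ge0// ltW.
rewrite ler_wpM2l// lerBlDr (@le_trans _ _ (expR (L * T)))//; last by rewrite lerDl.
rewrite (@le_trans _ _ (expR (h * L) ^+ N.+1))//.
  by rewrite lerXn2r ?nnegrE ?addr_ge0 ?mulr_ge0 ?expR_ge0 ?expR_ge1Dx// ltW.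
by rewrite -expRM_natl mulrA Nh ler_expR mulrC ler_wpM2l// ltW.
Qed.

(** A strict solution is an approximate solution with arbitrarily small [e]. *)
Lemma strict_sol_unique T L p q : 0 < L -> lipschitz_upto T L ->
  (forall t, 0 <= t <= T -> S (p t)) -> (forall t, 0 <= t <= T -> S (q t)) ->
  udist_le 0 (p 0) (q 0) -> strict_sol T p -> strict_sol T q ->
  forall t, 0 <= t <= T -> udist_le 0 (p t) (q t).
Proof.
move=> L0 lip Sp Sq pq0 sp sq t tT x Ax.
apply/ler_addgt0Pr => e e0; rewrite add0r.
set c := 2 / L * expR (L * T).
have c0 : 0 < c by rewrite mulr_gt0 ?divr_gt0 ?expR_gt0.
have ec0 : 0 < e / c by rewrite divr_gt0.
have [d1 d10 a1] := sp _ ec0; have [d2 d20 a2] := sq _ ec0.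
have /approx_sol_le/(_ a1) b1 : Num.min d1 d2 <= d1 by rewrite ge_min lexx.
have /approx_sol_le/(_ a2) b2 : Num.min d1 d2 <= d2 by rewrite ge_min lexx orbT.
have d0 : 0 < Num.min d1 d2 by rewrite lt_min d10.
have := approx_sol_dist L0 (ltW ec0) d0 lip Sp Sq pq0 b1 b2 tT Ax.
move=> /le_trans; apply.
suff -> : 2 * (e / c) / L * expR (L * T) = e by [].
transitivity (e / c * c); last by rewrite divfK// gt_eqF.
by move: (e / c) => z; rewrite /c; ring.
Qed.

Section polygon.
Variables (phi0 : X -> R) (h : R).

Fixpoint euler_node (k : nat) : X -> R :=
  if k is j.+1 then
    fun x => euler_node j x + h * F (j%:R * h) (euler_node j) x
  else phi0.

Definition euler_velocity k := F (k%:R * h) (euler_node k).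

(** The affine function of time that the polygon follows on its [k]-th cell. *)
Definition euler_line k t x := euler_node k x + (t - k%:R * h) * euler_velocity k x.

Definition euler_polygon t := euler_line (Num.truncn (t / h)) t.

Hypothesis h0 : 0 < h.

Lemma cell_itv t : 0 <= t ->
  (Num.truncn (t / h))%:R * h <= t < (Num.truncn (t / h)).+1%:R * h.
Proof.
move=> t0; have /truncn_itv : 0 <= t / h by rewrite divr_ge0// ltW.
by rewrite ler_pdivlMr// ltr_pdivrMr.
Qed.

Lemma euler_polygon_node k : euler_polygon (k%:R * h) = euler_node k.
Proof.
apply/funext => x; rewrite /euler_polygon mulfK ?gt_eqF// natrK.
by rewrite /euler_line subrr mul0r addr0.
Qed.

Lemma euler_polygon0 : euler_polygon 0 = phi0.
Proof. by have := euler_polygon_node 0; rewrite mul0r. Qed.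

Lemma euler_line_next k x : euler_line k (k.+1%:R * h) x = euler_node k.+1 x.
Proof.
by rewrite /euler_line (_ : k.+1%:R * h - k%:R * h = h) // -natr1; ring.
Qed.

(** On each cell the velocity is constant, so that a polygon moves with velocity
    [c] up to [e] as soon as all the cells that it meets have a velocity within
    [e] of [c].  The endpoint [k.+1 * h] of a cell counts as a time in it,
    which is what lets the induction pass from a cell to the next one. *)
Lemma euler_line_increment x c e s j t k : (j <= k)%N ->
  j%:R * h <= s -> s < j.+1%:R * h -> s <= t ->
  k%:R * h <= t -> t <= k.+1%:R * h ->
  (forall i, i%:R * h <= t -> s < i.+1%:R * h -> `|euler_velocity i x - c| <= e) ->
  `|euler_line k t x - euler_line j s x - (t - s) * c| <= e * (t - s).
Proof.
have same_cell i r r' : r <= r' -> `|euler_velocity i x - c| <= e ->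
    `|euler_line i r' x - euler_line i r x - (r' - r) * c| <= e * (r' - r).
  move=> rr' H; rewrite /euler_line.
  rewrite [X in `|X|](_ : _ = (r' - r) * (euler_velocity i x - c)); last by ring.
  by rewrite normrM ger0_norm ?subr_ge0// mulrC ler_wpM2r// subr_ge0.
elim: k t => [|k IH] t.
  rewrite leqn0 => /eqP -> js sj st kt tk vel.
  by apply: same_cell => //; exact: vel.
rewrite leq_eqVlt => /predU1P[<- js sj st kt tk vel|].
  by apply: same_cell => //; exact: vel.
rewrite ltnS => jk js sj st kt tk vel.
have kk : k%:R * h <= k.+1%:R * h by rewrite ler_wpM2r ?ler_nat// ltW.
have sk : s <= k.+1%:R * h.
  by rewrite (le_trans (ltW sj))// ler_wpM2r ?ler_nat// ltW.
have sk2 : s < k.+2%:R * h by rewrite (le_lt_trans sk)// ltr_pM2r// ltr_nat.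
(* Both affine pieces pass through the node [k.+1], so that the increments
   before and after it add up. *)
have := IH _ jk js sj sk kk (lexx _) (fun i ik si => vel i (le_trans ik kt) si).
have := same_cell k.+1 _ _ kt (vel _ kt sk2).
have -> : euler_line k.+1 (k.+1%:R * h) x = euler_node k.+1 x.
  by rewrite /euler_line subrr mul0r addr0.
rewrite euler_line_next !ler_norml => /andP[? ?] /andP[? ?].
by apply/andP; split; lra.
Qed.

Lemma euler_polygon_increment x c e s t : 0 <= s -> s <= t ->
  (forall i, i%:R * h <= t -> s < i.+1%:R * h -> `|euler_velocity i x - c| <= e) ->
  `|euler_polygon t x - euler_polygon s x - (t - s) * c| <= e * (t - s).
Proof.
move=> s0 st vel; have t0 := le_trans s0 st.
have /andP[s1 s2] := cell_itv s0; have /andP[t1 t2] := cell_itv t0.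
apply: euler_line_increment => //; last exact: ltW.
by rewrite le_truncn// ler_wpM2r// invr_ge0 ltW.
Qed.

Variables (T L B h1 : R).
Hypotheses (hh1 : h <= h1) (Sphi0 : S phi0) (inv : euler_invariant_upto T h1)
  (bd : bounded_upto T B) (lip : lipschitz_upto T L) (L0 : 0 <= L).

Lemma euler_node_in k : k%:R * h <= T -> S (euler_node k).
Proof.
elim: k => [//|k IH kT]; have kk : k%:R * h <= T.
  by rewrite (le_trans _ kT)// ler_wpM2r ?ler_nat// ltW.
by apply: inv; rewrite ?mulr_ge0 ?(ltW h0)//; exact: IH.
Qed.

Lemma euler_polygon_in t : 0 <= t <= T -> S (euler_polygon t).
Proof.
move=> /andP[t0 tT]; have /andP[t1 t2] := cell_itv t0.
have kT := le_trans t1 tT.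
apply: inv; first by rewrite mulr_ge0 ?(ltW h0).
  exact: euler_node_in.
rewrite subr_ge0 t1/= (le_trans _ hh1)// lerBlDr.
by move: t2; rewrite -natr1 mulrDl mul1r addrC => /ltW.
Qed.

(** The case of velocity [c = 0] with error [B]. *)
Lemma euler_polygon_lipschitz s t : 0 <= s -> s <= t -> t <= T ->
  udist_le (B * (t - s)) (euler_polygon t) (euler_polygon s).
Proof.
move=> s0 st tT x Ax.
have := @euler_polygon_increment x 0 B s t s0 st.
rewrite mulr0 subr0; apply=> i it si; rewrite subr0.
have iT := le_trans it tT.
by apply: bd => //; [rewrite iT mulr_ge0// ltW|exact: euler_node_in].
Qed.

(** All velocities used between [s] and [t] are values of [F] at a time within
    [dl] of [s] and at a state within [B dl] of the state at [s], hence within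
    [2 e] of [F s (p s)] by equicontinuity and by the Lipschitz condition. *)
Lemma euler_polygon_approx e dl : 0 < e -> h <= dl -> L * (B * dl) <= e ->
  (forall s t phi, 0 <= s <= T -> 0 <= t <= T -> `|s - t| <= dl -> S phi ->
    udist_le e (F s phi) (F t phi)) ->
  approx_sol T (2 * e) dl euler_polygon.
Proof.
move=> e0 hdl LBe equi s t s0 st tT tsd x Ax.
apply: euler_polygon_increment => // k kt sk.
have kT := le_trans kt tT.
have k0 : 0 <= k%:R * h by rewrite mulr_ge0// ltW.
have sT : 0 <= s <= T by rewrite s0 (le_trans st).
have kT' : 0 <= k%:R * h <= T by rewrite k0.
have ksd : `|k%:R * h - s| <= dl.
  rewrite ler_norml; apply/andP; split; last lra.
  by move: sk; rewrite -natr1; lra.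
have B0 : 0 <= B.
  by apply: le_trans (bd kT' (euler_node_in kT) Ax).
have dist : udist_le (B * dl) (euler_node k) (euler_polygon s).
  rewrite -euler_polygon_node => y Ay.
  have [ks|/ltW ks] := leP (k%:R * h) s.
    rewrite distrC (le_trans (euler_polygon_lipschitz k0 ks (le_trans st tT) Ay))//.
    by rewrite ler_wpM2l// (le_trans _ ksd)// distrC ler_norm.
  rewrite (le_trans (euler_polygon_lipschitz s0 ks kT Ay))//.
  by rewrite ler_wpM2l// (le_trans _ ksd)// ler_norm.
have H1 := lip kT' (euler_node_in kT) (euler_polygon_in sT) dist Ax.
have H2 := equi _ _ _ kT' sT ksd (euler_polygon_in sT) x Ax.
rewrite /euler_velocity; move: (le_trans H1 LBe) H2.
rewrite !ler_norml => /andP[? ?] /andP[? ?].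
by apply/andP; split; lra.
Qed.

End polygon.

(** The constant [dl] does not depend on the approximation [p], so that the
    estimate survives uniform limits. *)
Lemma approx_sol_lim T L e dl u : 0 <= T -> 0 < L -> lipschitz_upto T L ->
  (forall t, 0 <= t <= T -> S (u t)) ->
  (forall e', 0 < e' -> exists p, [/\ forall t, 0 <= t <= T -> S (p t),
    (forall t, 0 <= t <= T -> udist_le e' (u t) (p t)) & approx_sol T e dl p]) ->
  approx_sol T e dl u.
Proof.
move=> T0 L0 lip Su up s t s0 st tT tsd x Ax.
apply/ler_addgt0Pr => e1 e10.
(* Replacing [u] by [p] costs [e'] at both times, and at most [T L e'] in the
   field. *)
set c := 2 + T * L; have c0 : 0 < c by rewrite ltr_wpDr// mulr_ge0// ltW.
have e'0 : 0 < e1 / c by rewrite divr_gt0.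
have [p [Sp upp ap]] := up _ e'0.
have sT : 0 <= s <= T by rewrite s0 (le_trans st).
have tT' : 0 <= t <= T by rewrite (le_trans s0 st).
have H1 := upp _ sT x Ax; have H2 := upp _ tT' x Ax.
have H3 := lip _ _ _ _ sT (Su _ sT) (Sp _ sT) (upp _ sT) x Ax.
have H4 := ap _ _ s0 st tT tsd x Ax.
have ts0 : 0 <= t - s by rewrite subr_ge0.
have H5 : `|(t - s) * (F s (u s) x - F s (p s) x)| <= T * L * (e1 / c).
  rewrite normrM (ger0_norm ts0) -mulrA ler_pM//.
  by rewrite lerBlDr (le_trans tT)// lerDl.
have : (2 + T * L) * (e1 / c) = e1 by rewrite mulrC divfK// gt_eqF.
move: (e1 / c) H1 H2 H4 H5 => e2.
rewrite !ler_norml => /andP[? ?] /andP[? ?] /andP[? ?] /andP[? ?] E.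
by apply/andP; split; lra.
Qed.

Lemma limn_dist_cauchy (a : nat -> R) :
  (forall e, 0 < e -> exists N0, forall N M, (N0 <= N)%N -> (N0 <= M)%N ->
    `|a N - a M| <= e) ->
  forall e, 0 < e -> forall N0,
  (forall N M, (N0 <= N)%N -> (N0 <= M)%N -> `|a N - a M| <= e) ->
  forall N, (N0 <= N)%N -> `|limn a - a N| <= e.
Proof.
move=> ca; have cvga : cvgn a.
  apply/cauchy_cvgP; apply: cauchy_exP => _/posnumP[e].
  have e20 : 0 < e%:num / 2 by [].
  have [N0 aN0] := ca _ e20; exists (a N0).
  exists N0 => // n /= N0n.
  by rewrite /ball/= (le_lt_trans (aN0 _ _ (leqnn _) N0n))// ltr_pdivrMr// ltr_pMr// ltr1n.
move=> e e0 N0 aN0 N N0N; apply/ler_addgt0Pr => e1 e10.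
have /cvgrPdist_le/(_ _ e10)[M _ aM] := cvga.
have := aM (maxn M N0) (leq_maxl _ _).
have := aN0 (maxn M N0) N (leq_maxr _ _) N0N.
rewrite !ler_norml => /andP[? ?] /andP[? ?].
by apply/andP; split; lra.
Qed.

(** Euler polygons with mesh going to [0] are approximate solutions with the same
    [dl] and arbitrarily small [e]; by [approx_sol_dist] they form a uniform
    Cauchy sequence, and its limit is a strict solution. *)
Lemma strict_sol_exists_upto T L B h1 phi0 : unif_closed -> 0 <= T -> 0 < L ->
  0 < h1 -> S phi0 -> euler_invariant_upto T h1 -> bounded_upto T B ->
  lipschitz_upto T L -> equicontinuous_upto T ->
  exists u, [/\ udist_le 0 (u 0) phi0, forall t, 0 <= t <= T -> S (u t) &
    strict_sol T u].
Proof.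
move=> clS T0 L0 h10 Sphi0 inv bd lip equi.
have fine_mesh e : 0 < e -> exists2 eta, 0 < eta & forall h, 0 < h <= eta ->
    h <= h1 /\ approx_sol T e eta (euler_polygon phi0 h).
  move=> e0; have e20 : 0 < e / 2 by rewrite divr_gt0.
  have [dl dl0 edl] := equi _ e20.
  have c0 : 0 < L * (`|B| + 1) by rewrite mulr_gt0// ltr_wpDl.
  (* The third bound makes the drift [L (B eta)] of the field along the polygon
     at most [e / 2]. *)
  pose eta := Num.min dl (Num.min h1 (e / 2 / (L * (`|B| + 1)))).
  have eta0 : 0 < eta by rewrite !lt_min dl0 h10/= divr_gt0.
  exists eta => // h /andP[h0 heta].
  have hh1 : h <= h1 by rewrite (le_trans heta)// !ge_min lexx orbT.
  split => //; rewrite (_ : e = 2 * (e / 2)); last by field.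
  apply: (@euler_polygon_approx _ _ h0 _ _ B _ hh1 Sphi0 inv bd lip) => //.
    rewrite (@le_trans _ _ (L * (`|B| + 1) * eta))//.
      rewrite -mulrA ler_wpM2l ?(ltW L0)// ler_wpM2r ?(ltW eta0)//.
      by rewrite (le_trans (ler_norm _))// lerDl.
    by rewrite mulrC -ler_pdivlMr// !ge_min lexx !orbT.
  move=> s t phi sT tT st; apply: edl => //.
  by rewrite (le_trans st)// ge_min lexx.
pose hN (N : nat) := h1 / N.+1%:R.
have hN0 N : 0 < hN N by rewrite divr_gt0.
have hNsmall eta : 0 < eta -> exists N0, forall N, (N0 <= N)%N -> hN N <= eta.
  move=> eta0; exists (Num.truncn (h1 / eta)) => N N0N.
  rewrite /hN ler_pdivrMr// mulrC -ler_pdivrMr// ltW//.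
  by rewrite (lt_le_trans (truncnS_gt _))// ler_nat ltnS.
pose p N := euler_polygon phi0 (hN N).
have hNle N : hN N <= h1 by rewrite ler_pdivrMr// ler_peMr ?(ltW h10)// ler1n.
have Sp N t : 0 <= t <= T -> S (p N t).
  by move=> tT; apply: (euler_polygon_in (hN0 N) (hNle N) Sphi0 inv).
have cauchy e : 0 < e -> exists N0, forall N M, (N0 <= N)%N -> (N0 <= M)%N ->
    forall t, 0 <= t <= T -> udist_le e (p N t) (p M t).
  move=> e0; pose c := 2 / L * expR (L * T).
  have c0 : 0 < c by rewrite mulr_gt0 ?divr_gt0 ?expR_gt0.
  have ec0 : 0 < e / c by rewrite divr_gt0.
  have [eta eta0 Heta] := fine_mesh _ ec0.
  have [N0 HN0] := hNsmall _ eta0.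
  exists N0 => N M N0N N0M t tT.
  have [_ aN] : hN N <= h1 /\ approx_sol T (e / c) eta (p N).
    by apply: Heta; rewrite hN0 HN0.
  have [_ aM] : hN M <= h1 /\ approx_sol T (e / c) eta (p M).
    by apply: Heta; rewrite hN0 HN0.
  have p0 : udist_le 0 (p N 0) (p M 0).
    by move=> x Ax; rewrite /p !euler_polygon0// subrr normr0.
  move=> x Ax.
  have := approx_sol_dist L0 (ltW ec0) eta0 lip (Sp N) (Sp M) p0 aN aM tT Ax.
  suff -> : 2 * (e / c) / L * expR (L * T) = e by [].
  transitivity (e / c * c); last by rewrite divfK// gt_eqF.
  by move: (e / c) => z; rewrite /c; ring.
pose u t x := limn (fun N => p N t x).
have pu e : 0 < e -> exists N0, forall N, (N0 <= N)%N ->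
    forall t, 0 <= t <= T -> udist_le e (u t) (p N t).
  move=> e0; have [N0 HN0] := cauchy _ e0.
  exists N0 => N N0N t tT x Ax.
  apply: limn_dist_cauchy N0N => // [e' e'0|N' M' N0N' N0M'].
    have [N1 HN1] := cauchy _ e'0.
    by exists N1 => N' M' N1N' N1M'; exact: HN1.
  exact: HN0.
have Su t : 0 <= t <= T -> S (u t).
  move=> tT; apply: clS => e e0; have [N0 HN0] := pu _ e0.
  by exists (p N0 t); [exact: Sp|exact: HN0].
exists u; split => //.
  move=> x Ax; apply/ler_addgt0Pr => e e0; rewrite add0r.
  have [N0 HN0] := pu _ e0.
  have := HN0 _ (leqnn _) 0; rewrite lexx T0 => /(_ isT x Ax).
  by rewrite /p euler_polygon0.
move=> e e0; have [eta eta0 Heta] := fine_mesh _ e0.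
exists eta => //; apply: (approx_sol_lim T0 L0 lip Su) => e' e'0.
have [N0 HN0] := pu _ e'0; have [N1 HN1] := hNsmall _ eta0.
exists (p (maxn N0 N1)); split; [exact: Sp| |].
  by apply: HN0; rewrite leq_maxl.
by apply: (Heta _ _).2; rewrite hN0 HN1// leq_maxr.
Qed.

Lemma strict_sol_upto_le T T' u : T' <= T -> strict_sol T u -> strict_sol T' u.
Proof.
move=> TT su e e0; have [dl dl0 H] := su _ e0; exists dl => //.
by move=> s t s0 st tT; apply: H => //; exact: le_trans TT.
Qed.

(** The constants may depend on [T]: the solutions on the intervals [[0, N + 1]]
    agree where they overlap by uniqueness, and are glued. *)
Lemma strict_sol_exists phi0 : unif_closed -> S phi0 ->
  (forall T, 0 < T -> exists2 L, 0 < L & lipschitz_upto T L) ->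
  (forall T, 0 < T -> exists2 h1, 0 < h1 & euler_invariant_upto T h1) ->
  (forall T, 0 < T -> exists B, bounded_upto T B) ->
  (forall T, 0 < T -> equicontinuous_upto T) ->
  exists u, [/\ udist_le 0 (u 0) phi0, forall t, 0 <= t -> S (u t) &
    forall T, 0 < T -> strict_sol T u].
Proof.
move=> clS Sphi0 Hlip Hinv Hbd Hequi.
have loc (N : nat) : exists u, [/\ udist_le 0 (u 0) phi0,
    forall t, 0 <= t <= N.+1%:R -> S (u t) & strict_sol N.+1%:R u].
  have N0 : 0 < N.+1%:R :> R by [].
  have [L L0 lip] := Hlip _ N0; have [h1 h10 inv] := Hinv _ N0.
  have [B bd] := Hbd _ N0; have equi := Hequi _ N0.
  exact: (strict_sol_exists_upto clS (ltW N0) L0 h10 Sphi0 inv bd lip equi).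
have [U HU] := choice loc.
have agree (N M : nat) : (N <= M)%N -> forall t, 0 <= t <= N.+1%:R ->
    udist_le 0 (U N t) (U M t).
  move=> NM; have [U0 SU sU] := HU N; have [W0 SW sW] := HU M.
  have NM' : N.+1%:R <= M.+1%:R :> R by rewrite ler_nat.
  have [L L0 lip] := Hlip N.+1%:R (ltr0Sn _ _).
  apply: (strict_sol_unique L0 lip SU) => //.
  - by move=> t /andP[t0 tN]; apply: SW; rewrite t0 (le_trans tN).
  - move=> x Ax; have := U0 x Ax; have := W0 x Ax.
    by rewrite !normr_le0 !subr_eq0 => /eqP -> /eqP ->.
  - exact: strict_sol_upto_le sW.
pose u t := U (Num.truncn t) t.
have uU (N : nat) t : 0 <= t <= N.+1%:R -> t < N.+1%:R -> udist_le 0 (u t) (U N t).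
  move=> /andP[t0 _] tN; apply: agree.
    by rewrite -ltnS -(ltr_nat R) (le_lt_trans _ tN)// truncn_le.
  by rewrite t0 ltW// truncnS_gt.
have Su t : 0 <= t -> S (u t).
  move=> t0; have [_ + _] := HU (Num.truncn t); apply.
  by rewrite t0 ltW// truncnS_gt.
exists u; split => //.
  by rewrite /u; have [+ _ _] := HU (Num.truncn (0 : R)).
move=> T T0 e e0; pose N := Num.truncn T.
have TN : T < N.+1%:R by exact: truncnS_gt.
have [_ SU sN] := HU N.
have [dl dl0 H] := strict_sol_upto_le (ltW TN) sN e0; exists dl => //.
have [L L0 lip] := Hlip _ T0.
have eqU t x : 0 <= t <= T -> A x -> u t x = U N t x.
  move=> /andP[t0 tT] Ax; apply/eqP; rewrite -subr_eq0 -normr_le0.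
  by apply: uU => //; rewrite ?t0/= ?(ltW (le_lt_trans tT TN))// (le_lt_trans tT TN).
move=> s t s0 st tT tsd x Ax.
have sT : 0 <= s <= T by rewrite s0 (le_trans st).
have -> : F s (u s) x = F s (U N s) x.
  apply/eqP; rewrite -subr_eq0 -normr_le0 -(mulr0 L); apply: lip => //.
  - exact: Su.
  - by apply: SU; rewrite s0 (ltW (le_lt_trans (le_trans st tT) TN)).
  - by move=> y Ay; rewrite eqU// subrr normr0.
by rewrite !eqU// ?(le_trans s0 st)//; exact: H.
Qed.

Lemma field_along_curve T L C dl0 u : 0 < L -> 0 <= C -> 0 < dl0 ->
  lipschitz_upto T L -> equicontinuous_upto T ->
  (forall t, 0 <= t <= T -> S (u t)) ->
  (forall s t, 0 <= s <= T -> 0 <= t <= T -> `|s - t| <= dl0 ->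
    udist_le (C * `|s - t|) (u s) (u t)) ->
  forall e, 0 < e -> exists2 dl, 0 < dl & forall s t, 0 <= s <= T -> 0 <= t <= T ->
    `|s - t| <= dl -> udist_le e (F s (u s)) (F t (u t)).
Proof.
move=> L0 C0 dl00 lip equi Su ulip e e0; have e20 : 0 < e / 2 by rewrite divr_gt0.
have [d1 d10 H1] := equi _ e20.
have LC0 : 0 < L * (C + 1) by rewrite mulr_gt0// ltr_wpDl.
pose d2 := e / 2 / (L * (C + 1)).
have d20 : 0 < d2 by rewrite divr_gt0.
exists (Num.min dl0 (Num.min d1 d2)); first by rewrite !lt_min dl00 d10.
move=> s t sT tT; rewrite !le_min => /and3P[st0 st1 st2] x Ax.
have h1 := H1 s t (u s) sT tT st1 (Su _ sT) x Ax.
have h2 := lip t _ _ _ tT (Su _ sT) (Su _ tT) (ulip _ _ sT tT st0) x Ax.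
have h3 : L * (C * `|s - t|) <= e / 2.
  rewrite (@le_trans _ _ (L * (C + 1) * `|s - t|))//.
    by rewrite -mulrA ler_wpM2l ?(ltW L0)// ler_wpM2r// lerDl.
  by rewrite mulrC -ler_pdivlMr.
move: h1 (le_trans h2 h3); rewrite !ler_norml => /andP[? ?] /andP[? ?].
by apply/andP; split; lra.
Qed.

Lemma strict_sol_lipschitz T B u : bounded_upto T B ->
  (forall t, 0 <= t <= T -> S (u t)) -> strict_sol T u ->
  exists2 dl, 0 < dl & forall s t, 0 <= s <= T -> 0 <= t <= T -> `|s - t| <= dl ->
    udist_le ((`|B| + 1) * `|s - t|) (u s) (u t).
Proof.
move=> bd Su su; have [dl dl0 H] := su 1 ltr01; exists dl => //.
have main s t : 0 <= s -> s <= t -> t <= T -> t - s <= dl ->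
    udist_le ((`|B| + 1) * (t - s)) (u t) (u s).
  move=> s0 st tT tsd x Ax; have := H s t s0 st tT tsd x Ax.
  have sT : 0 <= s <= T by rewrite s0 (le_trans st).
  have ts0 : 0 <= t - s by rewrite subr_ge0.
  have : `|(t - s) * F s (u s) x| <= `|B| * (t - s).
    rewrite normrM ger0_norm// mulrC ler_wpM2r//.
    by rewrite (le_trans (bd s (u s) x sT (Su _ sT) Ax))// ler_norm.
  rewrite !ler_norml => /andP[? ?] /andP[? ?]; apply/andP; split; lra.
move=> s t /andP[s0 sT] /andP[t0 tT] st x Ax.
have [le_st|/ltW le_ts] := leP s t.
  rewrite distrC [in X in _ <= _ * X]distrC (@ger0_norm _ (t - s)) ?subr_ge0//; apply: main => //.
  by rewrite (le_trans _ st)// distrC ler_norm.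
rewrite (@ger0_norm _ (s - t)) ?subr_ge0//; apply: main => //.
by rewrite (le_trans _ st)// ler_norm.
Qed.

(** A strict solution is differentiable, uniformly over [A], also backwards in
    time: for [s < t] the field at [s] is exchanged for the field at [t]. *)
Lemma strict_sol_derivative T L B u : 0 < L -> bounded_upto T B ->
  lipschitz_upto T L -> equicontinuous_upto T ->
  (forall t, 0 <= t <= T -> S (u t)) -> strict_sol T u ->
  forall e, 0 < e -> exists2 dl, 0 < dl & forall s t, 0 <= s <= T -> 0 <= t <= T ->
    `|s - t| <= dl -> forall x, A x ->
    `|u s x - u t x - (s - t) * F t (u t) x| <= e * `|s - t|.
Proof.
move=> L0 bd lip equi Su su e e0; have e20 : 0 < e / 2 by rewrite divr_gt0.
have [dl0 dl00 ulip] := strict_sol_lipschitz bd Su su.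
have C0 : 0 <= `|B| + 1 by rewrite addr_ge0.
have [d1 d10 H1] := field_along_curve L0 C0 dl00 lip equi Su ulip e20.
have [d2 d20 H2] := su _ e20.
exists (Num.min d1 d2); first by rewrite lt_min d10.
move=> s t sT tT; rewrite le_min => /andP[st1 st2] x Ax.
have /andP[s0 sT'] := sT; have /andP[t0 tT'] := tT.
have [le_ts|/ltW le_st] := leP t s.
  have ts0 : 0 <= s - t by rewrite subr_ge0.
  rewrite ger0_norm// in st2; rewrite (ger0_norm ts0).
  apply: le_trans (H2 t s t0 le_ts sT' st2 x Ax) _.
  by rewrite ler_wpM2r// ler_pdivrMr// ler_peMr ?ler1n// ltW.
have st0 : 0 <= t - s by rewrite subr_ge0.
have := H1 s t sT tT st1 x Ax.
rewrite (distrC s t) (ger0_norm st0) in st2; rewrite (distrC s t) (ger0_norm st0).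
have := H2 s t s0 le_st tT' st2 x Ax.
set a := F _ _ _; set b := F _ _ _ => h1 h2.
have : `|(t - s) * (a - b)| <= e / 2 * (t - s).
  by rewrite normrM (ger0_norm st0) mulrC ler_wpM2r.
move: h1; rewrite !ler_norml => /andP[? ?] /andP[? ?].
by apply/andP; split; lra.
Qed.

(** A solution that is only assumed to be differentiable pointwise is a strict
    solution: by the mean value theorem its increments are values of the field
    along it, whose boundedness makes it Lipschitz in time uniformly over [A],
    and then the field along it is uniformly continuous in time. *)
Lemma classical_strict_sol T L B w : 0 < L -> 0 <= B -> bounded_upto T B ->
  lipschitz_upto T L -> equicontinuous_upto T ->
  (forall t, 0 <= t <= T -> S (w t)) ->
  (forall x, A x -> {within [set t : R | 0 <= t], continuous (fun t => w t x)}) ->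
  (forall x (t : R), A x -> 0 < t -> is_derive t 1 (fun s => w s x) (F t (w t) x)) ->
  strict_sol T w.
Proof.
move=> L0 B0 bd lip equi Sw cw dw.
have mvt s t x : A x -> 0 <= s -> s <= t -> t <= T ->
    exists2 c, s <= c <= t & w t x - w s x = F c (w c) x * (t - s).
  move=> Ax s0 st tT.
  have [||c] := @MVT_segment R (fun r => w r x) (fun r => F r (w r) x) s t st.
  - move=> r; rewrite in_itv/= => /andP[sr _]; apply: dw => //.
    exact: le_lt_trans sr.
  - apply: continuous_subspaceW (cw x Ax) => r /=.
    by rewrite in_itv/= => /andP[sr _]; exact: le_trans sr.
  - by rewrite in_itv/= => ? ?; exists c.
have wlip s t : 0 <= s -> s <= t -> t <= T -> udist_le (B * (t - s)) (w t) (w s).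
  move=> s0 st tT x Ax; have [c /andP[sc ct] ->] := mvt s t x Ax s0 st tT.
  have cT : 0 <= c <= T by rewrite (le_trans s0 sc) (le_trans ct).
  rewrite normrM (@ger0_norm _ (t - s)) ?subr_ge0// ler_wpM2r ?subr_ge0//.
  exact: bd (Sw _ cT) Ax.
have wlip2 s t : 0 <= s <= T -> 0 <= t <= T -> `|s - t| <= 1 ->
    udist_le (B * `|s - t|) (w s) (w t).
  move=> /andP[s0 sT] /andP[t0 tT] _ x Ax.
  have [le_st|/ltW le_ts] := leP s t.
    by rewrite distrC [in X in _ <= _ * X]distrC (@ger0_norm _ (t - s)) ?subr_ge0//; exact: wlip.
  by rewrite (@ger0_norm _ (s - t)) ?subr_ge0//; exact: wlip.
move=> e e0; have [dl dl0 H] := field_along_curve L0 B0 ltr01 lip equi Sw wlip2 e0.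
exists dl => // s t s0 st tT tsd x Ax.
have [c /andP[sc ct] ->] := mvt s t x Ax s0 st tT.
have cT : 0 <= c <= T by rewrite (le_trans s0 sc) (le_trans ct).
have sT : 0 <= s <= T by rewrite s0 (le_trans st).
have ts0 : 0 <= t - s by rewrite subr_ge0.
rewrite mulrC -mulrBr normrM (ger0_norm ts0) mulrC ler_wpM2r//.
by apply: H => //; rewrite ger0_norm ?subr_ge0// (le_trans _ tsd)// lerB.
Qed.

End ode.

(** * Lebesgue measure on R^n: half-spaces and reflections *)
Section lebesgue_rV_theory.
Context {R : realType} {n : nat}.
Implicit Types (A : set 'rV[R]_n) (B : option ('rV[R]_n * 'rV[R]_n)).

Lemma lebesgue_outer_bigcup_le A (G : nat -> set 'rV[R]_n) :
  A `<=` \bigcup_k G k -> (lebesgue_outer A <= \sum_(k <oo) lebesgue_outer (G k))%E.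
Proof.
move=> AG; apply: le_trans (le_lebesgue_outer AG) _.
exact: lebesgue_outer_sigma_subadditive.
Qed.

Lemma lebesgue_outer_box B : (lebesgue_outer (box B) <= box_volume B)%E.
Proof.
apply: ereal_inf_lbound; exists (fun k => if k == 0%N then B else None).
  by move=> x Bx; exists 0%N.
rewrite nneseries_recl//= => [|k _]; last exact: box_volume_ge0.
rewrite (@eseries0 _ _ 1 xpredT) ?adde0// => k k1 _.
by rewrite gt_eqF.
Qed.

(** A half-space orthogonal to an axis cuts each box of a cover into two boxes
    whose volumes add up to the volume of the given one. *)
Lemma measurable_lower_halfspace i (c : R) :
  measurable ([set x | x 0 i <= c] : set (lebesgue_rV R n)).
Proof.
apply: le_caratheodory_measurable => X.
set H := [set x | _].
have split_box B : (lebesgue_outer (box B `&` H) + lebesgue_outer (box B `&` ~` H)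
    <= box_volume B)%E.
  case: B => [[a b]|]; last first.
    by rewrite /= !set0I lebesgue_outer0 adde0.
  pose upd (y : 'rV[R]_n) r := \row_j (if j == i then r else y 0 j).
  pose B1 := Some (a, upd b (Num.min (b 0 i) c)).
  pose B2 := Some (upd a (Num.max (a 0 i) c), b).
  have H1 : box (Some (a, b)) `&` H `<=` box B1.
    move=> x [/= abx xc] j; have /andP[ax xb] := abx j.
    by rewrite ax mxE; case: eqP => [->|//]; rewrite le_min xc (andP (abx i)).2.
  have H2 : box (Some (a, b)) `&` ~` H `<=` box B2.
    move=> x [/= abx /negP]; rewrite -ltNge => xc j; have /andP[ax xb] := abx j.
    by rewrite xb mxE; case: eqP => [->|]; rewrite ?ax// gt_max xc (andP (abx i)).1.
  have := leeD (le_trans (le_lebesgue_outer H1) (lebesgue_outer_box B1))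
     (le_trans (le_lebesgue_outer H2) (lebesgue_outer_box B2)).
  move=> /le_trans; apply; rewrite /B1 /B2 /= -EFinD lee_fin.
  rewrite [X in X + _ <= _](bigD1 i)//= [X in _ + X <= _](bigD1 i)//=.
  rewrite [X in _ <= X](bigD1 i)//= !mxE eqxx.
  under eq_bigr => j ji do rewrite mxE (negbTE ji).
  under [X in _ + _ * X <= _]eq_bigr => j ji do rewrite mxE (negbTE ji).
  rewrite -mulrDl ler_wpM2r//.
    by apply: prodr_ge0 => j _; rewrite le_max lexx.
  rewrite /Num.min /Num.max; repeat case: ifPn; rewrite -?leNgt; lra.
apply: le_ereal_inf_tmp => _ [F XF <-].
apply: (@le_trans _ _ (\sum_(k <oo) (lebesgue_outer (box (F k) `&` H) +
    lebesgue_outer (box (F k) `&` ~` H)))%E).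
  rewrite nneseriesD => [|*|*]; try exact: lebesgue_outer_ge0.
  by apply: leeD; apply: lebesgue_outer_bigcup_le; rewrite -setI_bigcupl;
     exact: setSI.
apply: lee_nneseries => k *; last exact: split_box.
by apply: adde_ge0; exact: lebesgue_outer_ge0.
Qed.

Lemma measurable_coord i :
  measurable_fun setT (fun x : lebesgue_rV R n => x 0 i : measurableTypeR R).
Proof.
apply: (measurability _ (measurable_realfun.RGenOInfty.measurableE R)) => _ [_ [r ->] <-].
have := measurableC (measurable_lower_halfspace i r).
rewrite [X in measurable X -> _](_ : _ =
  [set: lebesgue_rV R n] `&` (fun x : lebesgue_rV R n => x 0 i) @^-1` `]r, +oo[)//.
rewrite setTI; apply/seteqP; split=> x /=; rewrite in_itv/= andbT ltNge.
  by move/negP.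
by move=> /negP.
Qed.

Lemma lebesgue_bounded_fin A : bounded_set A -> (lebesgue_outer A < +oo)%E.
Proof.
move=> [M [Mr AM]]; pose c : R := `|M| + 1.
have : A `<=` box (Some (const_mx (- c - 1), const_mx c)).
  move=> x Ax i; rewrite !mxE.
  have : `|x 0 i| <= c.
    apply: le_trans (AM c _ x Ax); last by rewrite /c ltr_pwDr// ler_norm.
    by rewrite [leRHS]/Num.Def.normr/= mx_normrE; apply/bigmax_geP; right; exists (0, i).
  by rewrite ler_norml => /andP[? ?]; apply/andP; split => //; lra.
move=> /le_lebesgue_outer/le_lt_trans; apply.
by apply: le_lt_trans (lebesgue_outer_box _) _; rewrite ltry.
Qed.

(** A reflected box is half-open on the other side; it is contained in a box
    whose sides are longer by [e], for every [e > 0]. *)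
Lemma lebesgue_outer_reflect_le (z : 'rV[R]_n) A :
  (lebesgue_outer [set y | A (z - y)%R] <= lebesgue_outer A)%E.
Proof.
have reflect_box B : (lebesgue_outer [set y | box B (z - y)%R] <= box_volume B)%E.
  case: B => [[a b]|]; last by rewrite /= lebesgue_outer0.
  have bound (e : R) : 0 < e -> (lebesgue_outer [set y | box (Some (a, b)) (z - y)%R] <=
      (\prod_i Num.max 0 (b 0 i - a 0 i + e))%:E)%E.
    move=> e0; pose a' := \row_i (z 0 i - b 0 i - e); pose b' := \row_i (z 0 i - a 0 i).
    have : [set y | box (Some (a, b)) (z - y)%R] `<=` box (Some (a', b')).
      move=> y /= aby i; have := aby i; rewrite !mxE => /andP[? ?].
      by apply/andP; split; lra.
    move=> /le_lebesgue_outer/le_trans; apply.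
    apply: le_trans (lebesgue_outer_box _) _; rewrite lee_fin.
    rewrite (eq_bigr (fun i => Num.max 0 (b 0 i - a 0 i + e)))// => i _.
    by rewrite !mxE; congr (Num.max _ _); ring.
  have lfin : lebesgue_outer [set y | box (Some (a, b)) (z - y)%R] \is a fin_num.
    rewrite ge0_fin_numE ?lebesgue_outer_ge0//.
    by rewrite (le_lt_trans (bound 1 ltr01))// ltry.
  rewrite -(fineK lfin) /= lee_fin.
  have cvgb : (\prod_i Num.max 0 (b 0 i - a 0 i + e)) @[e --> (0 : R)] -->
      \prod_i Num.max 0 (b 0 i - a 0 i + 0).
    apply: cvg_big => [|i _]; first exact: mul_continuous.
    apply: continuous_max; first exact: cvg_cst.
    by apply: cvgD; [exact: cvg_cst|exact: cvg_id].
  under [X in _ <= X]eq_bigr => i _ do rewrite -[_ - _]addr0.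
  apply: (cvgr_to_ge (cvg_at_right_filter cvgb)).
  near=> e; rewrite -lee_fin (fineK lfin); apply: bound.
  by near: e; exact: nbhs_right_gt.
apply: le_ereal_inf_tmp => _ [F AF <-].
apply: (@le_trans _ _ (\sum_(k <oo) lebesgue_outer [set y | box (F k) (z - y)%R])%E).
  by apply: lebesgue_outer_bigcup_le => y /= /AF[k _ Fk]; exists k.
by apply: lee_nneseries => k *; [exact: lebesgue_outer_ge0|exact: reflect_box].
Unshelve. all: by end_near. Qed.

Lemma lebesgue_outer_reflect (z : 'rV[R]_n) A :
  lebesgue_outer [set y | A (z - y)%R] = lebesgue_outer A.
Proof.
apply/eqP; rewrite eq_le lebesgue_outer_reflect_le/=.
have := lebesgue_outer_reflect_le z [set y | A (z - y)%R].
by rewrite /=; congr (lebesgue_outer _ <= _)%E; apply/seteqP; split=> y /=; rewrite subKr.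
Qed.

(** Typed as a map of the measurable space [lebesgue_rV R n] into itself, so that
    measurability and push-forward of measures apply to it. *)
Definition reflect_at (z : 'rV[R]_n) : lebesgue_rV R n -> lebesgue_rV R n :=
  fun y => z - y.

Lemma measurable_reflect (z : 'rV[R]_n) :
  measurable_fun setT (reflect_at z).
Proof.
move=> _ A mA; rewrite setTI.
have mA' : caratheodory_measurable (@lebesgue_outer R n) A by exact: mA.
suff : caratheodory_measurable (@lebesgue_outer R n) [set y | A (z - y)] by [].
move=> X; set A' := [set y | A (z - y)].
have reflI E E' : (forall y, E' (z - y) = E y) ->
    [set y | (X `&` E') (z - y)] = [set y | X (z - y)] `&` E.
  by move=> EE; apply/seteqP; split=> y /=; rewrite EE.
rewrite -(lebesgue_outer_reflect z X) mA'.
rewrite -(lebesgue_outer_reflect z (X `&` A')).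
rewrite -(lebesgue_outer_reflect z (X `&` ~` A')).
by rewrite (reflI A) ?(reflI (~` A))// => y; rewrite /A' /= subKr.
Qed.

Lemma ge0_integral_reflect (z : 'rV[R]_n) (D : set (lebesgue_rV R n)) (f : lebesgue_rV R n -> \bar R) :
  measurable D -> measurable_fun D f -> (forall x, D x -> (0 <= f x)%E) ->
  (\int[lebesgue]_(y in reflect_at z @^-1` D) f (reflect_at z y) = \int[lebesgue]_(y in D) f y)%E.
Proof.
move=> mD mf f0.
have f0' : {in D, forall y, (0 <= f y)%E} by move=> y; rewrite inE; exact: f0.
have := @ge0_integral_pushforward _ _ _ _ R _ (measurable_reflect z)
  (@lebesgue R n) D f mD mf f0'.
rewrite /comp => <-.
have push : pushforward (@lebesgue R n) (reflect_at z) =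
    @lebesgue R n.
  by apply/funext => E; exact: (lebesgue_outer_reflect z E).
by rewrite push.
Qed.

End lebesgue_rV_theory.

(** * Measurability of continuous functions of measurable vectors *)
Section measurable_comp.
Context {R : realType} {d} {T : measurableType d} {N : nat}.
Variables (A : set T) (psi : T -> 'rV[R]_N).
Hypotheses (mA : measurable A)
  (mpsi : forall i, measurable_fun A (fun x => psi x 0 i : measurableTypeR R)).

Let cube (qk : 'rV[rat]_N * nat) : set 'rV[R]_N :=
  [set y | forall i, `|ratr (qk.1 0 i) - y 0 i| < qk.2.+1%:R^-1].

(** An open set is the union of the countably many cubes with a rational centre
    and radius [1 / (k + 1)] that it contains, and the preimage of a cube is a
    finite intersection of preimages of intervals under the coordinates. *)
Lemma measurable_preimage_open (O : set 'rV[R]_N) :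
  open O -> measurable (A `&` psi @^-1` O).
Proof.
move=> oO.
have mcube qk : measurable (A `&` psi @^-1` cube qk).
  rewrite (_ : _ `&` _ = A `&` \bigcap_(i in [set: 'I_N])
      (A `&` (fun x => psi x 0 i) @^-1` ball (ratr (qk.1 0 i) : R) qk.2.+1%:R^-1)).
    apply: measurableI => //; apply: fin_bigcap_measurable => // i _.
    by apply: mpsi => //; apply: open_measurable; exact: ball_open.
  apply/seteqP; split => [x [Ax cx]|x [Ax cx]]; split => //.
    by move=> i _; split => //; exact: cx.
  by move=> i; have [] := cx i Logic.I.
rewrite (_ : _ `&` _ = \bigcup_qk
    (if `[< cube qk `<=` O >] then A `&` psi @^-1` cube qk else set0)).
  apply: countable_bigcupT_measurable => // qk.
  by case: ifP => _; [exact: mcube|exact: measurable0].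
apply/seteqP; split=> [x [Ax Ox]|x [qk _]]; last first.
  by case: ifPn => // /asboolP cO [Ax /cO].
have /nbhs_ballP[e /= e0 beO] : nbhs (psi x) O by exact: open_nbhs_nbhs.
have [k ke] : exists k : nat, 2 / e < k.+1%:R.
  by exists (Num.truncn (2 / e)); exact: truncnS_gt.
have k0 : 0 < k.+1%:R^-1 :> R by rewrite invr_gt0.
have ke2 : k.+1%:R^-1 + k.+1%:R^-1 < e.
  rewrite (_ : _ + _ = 2 / k.+1%:R); last by ring.
  by rewrite ltr_pdivrMr// mulrC -ltr_pdivrMr.
have near_rat (i : 'I_N) : exists r : rat, `|ratr r - psi x 0 i| < k.+1%:R^-1.
  have lt : psi x 0 i - k.+1%:R^-1 < psi x 0 i + k.+1%:R^-1.
    by move: k0; move: (k.+1%:R^-1 : R) => r r0; lra.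
  have [r] := rat_in_itvoo lt; rewrite in_itv/= => /andP[r1 r2].
  exists r; rewrite ltr_norml; move: r1 r2; move: (k.+1%:R^-1 : R) => r' ? ?.
  by apply/andP; split; lra.
have [q qx] := choice near_rat.
exists (\row_i q i, k) => //; case: ifPn => [_|/asboolPn]; last first.
  case=> y cy; apply: beO; rewrite mx_norm_ball /ball_/= /Num.Def.normr/= mx_normrE.
  apply/bigmax_ltP; split => // -[i j] _; rewrite !mxE/= ord1.
  have := cy j; have := qx j; rewrite !mxE /=.
  rewrite !ltr_norml; move: ke2; move: (k.+1%:R^-1 : R) => r ? /andP[? ?] /andP[? ?].
  by apply/andP; split; lra.
by split => // i; rewrite mxE; exact: qx.
Qed.

(** This covers both continuous functions of [x] and superpositions
    [g(t, x, phi x)] of a continuous [g] with a measurable [phi], taking the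
    vector [(x, phi x)] for [psi x]. *)
Lemma measurable_fun_continuous_comp (D : set 'rV[R]_N) (H : 'rV[R]_N -> R) :
  (forall x, A x -> D (psi x)) -> {within D, continuous H} ->
  measurable_fun A (fun x => H (psi x) : measurableTypeR R).
Proof.
move=> AD /continuousP cH.
apply: (measurability _ (RGenOpens.measurableE R)) => _ [_ [a [b ->] <-]].
have oab : open (`]a, b[%classic : set R) by exact: interval_open.
have /open_subspaceP[V oV VD] := cH _ oab.
rewrite (_ : _ `&` _ = A `&` psi @^-1` V); first exact: measurable_preimage_open.
apply/seteqP; split => x [Ax Hx]; split => //.
  have : (V `&` D) (psi x) by rewrite VD; split => //; exact: AD.
  by case.
have : ((H @^-1` `]a, b[) `&` D) (psi x) by rewrite -VD; split => //; exact: AD.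
by case.
Qed.

End measurable_comp.

Section lebesgue_rV_borel.
Context {R : realType} {n : nat}.

Lemma open_lebesgue_measurable (O : set 'rV[R]_n) :
  open O -> measurable (O : set (lebesgue_rV R n)).
Proof.
move=> oO; rewrite -(setTI O).
exact: (@measurable_preimage_open _ _ (lebesgue_rV R n) _ setT idfun measurableT measurable_coord).
Qed.

Lemma closed_lebesgue_measurable (C : set 'rV[R]_n) :
  closed C -> measurable (C : set (lebesgue_rV R n)).
Proof.
move=> /closed_openC/open_lebesgue_measurable/measurableC.
by rewrite setCK.
Qed.

Lemma continuous_lebesgue_measurable (D : set 'rV[R]_n) (H : 'rV[R]_n -> R) :
  measurable (D : set (lebesgue_rV R n)) -> {within D, continuous H} ->
  measurable_fun (D : set (lebesgue_rV R n)) (H : lebesgue_rV R n -> measurableTypeR R).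
Proof.
move=> mD cH.
pose id_rV (x : lebesgue_rV R n) : 'rV[R]_n := x.
have mid i : measurable_fun (D : set (lebesgue_rV R n)) (fun x => id_rV x 0 i : measurableTypeR R).
  by apply: measurable_funS (measurable_coord i).
exact: (measurable_fun_continuous_comp mD mid (fun x (Dx : D (id_rV x)) => Dx) cH).
Qed.

End lebesgue_rV_borel.

(** * Integral operators with probability kernels *)
Section kernel_integral.
Context {R : realType} {n : nat}.
Implicit Types (Om : set 'rV[R]_n) (k phi psi : 'rV[R]_n -> R).

Definition kernel_integral Om k phi (x : 'rV[R]_n) : R :=
  \int[lebesgue]_(y in Om) (k (x - y) * phi y).

Definition lebesgue_measurable_fun Om phi :=
  measurable_fun (Om : set (lebesgue_rV R n)) (phi : lebesgue_rV R n -> measurableTypeR R).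

Definition prob_kernel k := [/\ forall x, 0 <= k x, continuous k &
  (\int[lebesgue]_(x in [set: lebesgue_rV R n]) (k x)%:E)%E = 1%E].

Lemma measurable_translated_kernel Om k x : open Om -> continuous k ->
  lebesgue_measurable_fun Om (fun y => k (x - y)).
Proof.
move=> oOm ck; apply: continuous_lebesgue_measurable.
  exact: open_lebesgue_measurable.
apply: continuous_subspaceT => y.
have cB : {for y, continuous (fun y : 'rV[R]_n => x - y)}.
  by apply: continuousB; [exact: cst_continuous|exact: cvg_id].
exact: (continuous_comp cB (ck _)).
Qed.

(** The reflection [y |-> x - y] preserves Lebesgue measure, so that the kernel
    centred at [x] has mass [1] on the whole space. *)
Lemma kernel_mass_le1 Om k x : open Om -> prob_kernel k ->
  (\int[lebesgue]_(y in (Om : set (lebesgue_rV R n))) (k (x - y))%:E <= 1)%E.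
Proof.
move=> oOm [k0 ck k1].
have mk : measurable_fun (setT : set (lebesgue_rV R n)) (fun y : lebesgue_rV R n => (k y)%:E).
  apply/measurable_EFinP; apply: continuous_lebesgue_measurable => //.
  exact: continuous_subspaceT.
have kE0 (y : lebesgue_rV R n) : [set: lebesgue_rV R n] y -> (0 <= (k y)%:E)%E.
  by move=> _; rewrite lee_fin.
have := ge0_integral_reflect x measurableT mk kE0; rewrite k1 preimage_setT => <-.
have mOm : measurable (Om : set (lebesgue_rV R n)) by exact: open_lebesgue_measurable.
have mkx : measurable_fun (setT : set (lebesgue_rV R n))
    (fun y : lebesgue_rV R n => (k (reflect_at x y))%:E).
  apply/measurable_EFinP; exact: (measurable_translated_kernel x openT ck).
have kxE0 (y : lebesgue_rV R n) : [set: lebesgue_rV R n] y -> (0 <= (k (reflect_at x y))%:E)%E.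
  by move=> _; rewrite lee_fin.
have := @ge0_subset_integral _ _ R (@lebesgue R n) _ _ mOm measurableT _ mkx kxE0 (@subsetT _ _).
by [].
Qed.

Lemma integrable_kernel Om k x : open Om -> prob_kernel k ->
  (@lebesgue R n).-integrable Om (fun y => (k (x - y))%:E).
Proof.
move=> oOm hk; have [k0 ck k1] := hk; apply/integrableP; split.
  by apply/measurable_EFinP; apply: measurable_translated_kernel.
apply: (@le_lt_trans _ _ 1%E); last by rewrite ltry.
apply: le_trans (kernel_mass_le1 x oOm hk).
rewrite le_eqVlt; apply/orP; left; apply/eqP.
by apply: eq_integral => y _ /=; rewrite ger0_norm.
Qed.


Lemma integrable_kernel_mul Om k phi x c : open Om -> prob_kernel k ->
  lebesgue_measurable_fun Om phi -> (forall y, Om y -> `|phi y| <= c) ->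
  (@lebesgue R n).-integrable Om (fun y => (k (x - y) * phi y)%:E).
Proof.
move=> oOm hk mphi phic; have [k0 ck _] := hk.
have mOm : measurable (Om : set (lebesgue_rV R n)) by exact: open_lebesgue_measurable.
have := @integrableZl _ _ R (@lebesgue R n) _ mOm c _ (integrable_kernel x oOm hk).
apply: (@le_integrable _ _ R (@lebesgue R n) _ mOm).
  apply/measurable_EFinP; apply: measurable_funM => //.
  exact: measurable_translated_kernel.
move=> y Omy; rewrite /= lee_fin !normrM mulrC ler_wpM2r//.
by rewrite (le_trans (phic _ Omy))// ler_norm.
Qed.

Lemma le_kernel_integral Om k phi psi x c c' : open Om -> prob_kernel k ->
  lebesgue_measurable_fun Om phi -> (forall y, Om y -> `|phi y| <= c) ->
  lebesgue_measurable_fun Om psi -> (forall y, Om y -> `|psi y| <= c') ->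
  (forall y, Om y -> phi y <= psi y) ->
  kernel_integral Om k phi x <= kernel_integral Om k psi x.
Proof.
move=> oOm hk mphi phic mpsi psic le; have [k0 ck _] := hk.
have mOm : measurable (Om : set (lebesgue_rV R n)) by exact: open_lebesgue_measurable.
apply: (@le_Rintegral _ _ R (@lebesgue R n) _ _ _ mOm).
- exact: integrable_kernel_mul mphi phic.
- exact: integrable_kernel_mul mpsi psic.
- by move=> y Omy; rewrite ler_wpM2l// le.
Qed.

Lemma kernel_integral_cst Om k x c : open Om -> prob_kernel k -> 0 <= c ->
  kernel_integral Om k (fun=> c) x <= c.
Proof.
move=> oOm hk c0.
have mOm : measurable (Om : set (lebesgue_rV R n)) by exact: open_lebesgue_measurable.
rewrite /kernel_integral RintegralZr//; last exact: integrable_kernel.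
rewrite ler_piMl// /Rintegral -lee_fin fineK.
  exact: kernel_mass_le1.
by apply: integrable_fin_num => //; exact: integrable_kernel.
Qed.

Lemma kernel_integral_ge0 Om k phi x : prob_kernel k ->
  (forall y, Om y -> 0 <= phi y) -> 0 <= kernel_integral Om k phi x.
Proof.
by move=> [k0 _ _] phi0; apply: Rintegral_ge0 => y Omy; rewrite mulr_ge0// phi0.
Qed.

Lemma kernel_integral_le Om k phi x c : open Om -> prob_kernel k ->
  lebesgue_measurable_fun Om phi -> (forall y, Om y -> 0 <= phi y <= c) -> 0 <= c ->
  kernel_integral Om k phi x <= c.
Proof.
move=> oOm hk mphi phic c0.
apply: le_trans (kernel_integral_cst x oOm hk c0).
have phi_le y : Om y -> `|phi y| <= c by move=> /phic/andP[? ?]; rewrite ger0_norm.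
have c_le y : Om y -> `|c| <= c by move=> _; rewrite ger0_norm.
have mc : lebesgue_measurable_fun Om (fun=> c) by exact: measurable_cst.
apply: (le_kernel_integral x oOm hk mphi phi_le mc c_le).
by move=> y /phic/andP[].
Qed.

Lemma kernel_integral_dist Om k phi psi x c r : open Om -> prob_kernel k ->
  lebesgue_measurable_fun Om phi -> (forall y, Om y -> `|phi y| <= c) ->
  lebesgue_measurable_fun Om psi -> (forall y, Om y -> `|psi y| <= c) ->
  0 <= r -> (forall y, Om y -> `|phi y - psi y| <= r) ->
  `|kernel_integral Om k phi x - kernel_integral Om k psi x| <= r.
Proof.
move=> oOm hk mphi phic mpsi psic r0 dist; have [k0 ck _] := hk.
have mOm : measurable (Om : set (lebesgue_rV R n)) by exact: open_lebesgue_measurable.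
have iphi := integrable_kernel_mul x oOm hk mphi phic.
have ipsi := integrable_kernel_mul x oOm hk mpsi psic.
rewrite /kernel_integral -(RintegralB mOm iphi ipsi).
have iB := integrableB mOm iphi ipsi.
apply: le_trans (le_normr_Rintegral mOm iB) _.
apply: le_trans (kernel_integral_cst x oOm hk r0).
apply: le_Rintegral => //.
- exact: integrable_abse iB.
- have r_le y : Om y -> `|r| <= r by move=> _; rewrite ger0_norm.
  have mr : lebesgue_measurable_fun Om (fun=> r) by exact: measurable_cst.
  exact: (integrable_kernel_mul x oOm hk mr r_le).
- by move=> y Omy; rewrite -mulrBr normrM ger0_norm// ler_wpM2l// dist.
Qed.

Lemma kernel_integral_dist_kernel Om k k' phi x x' c eta : open Om ->
  (@lebesgue_outer R n Om < +oo)%E -> prob_kernel k -> prob_kernel k' ->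
  lebesgue_measurable_fun Om phi -> (forall y, Om y -> `|phi y| <= c) ->
  (forall y, Om y -> `|k (x - y) - k' (x' - y)| <= eta) -> 0 <= eta ->
  `|kernel_integral Om k phi x - kernel_integral Om k' phi x'| <=
    eta * c * fine (@lebesgue_outer R n Om).
Proof.
move=> oOm Omfin hk hk' mphi phic dist eta0.
have mOm : measurable (Om : set (lebesgue_rV R n)) by exact: open_lebesgue_measurable.
have i1 := integrable_kernel_mul x oOm hk mphi phic.
have i2 := integrable_kernel_mul x' oOm hk' mphi phic.
rewrite /kernel_integral -(RintegralB mOm i1 i2).
have iB := integrableB mOm i1 i2.
apply: le_trans (le_normr_Rintegral mOm iB) _.
have := @Rintegral_cst _ _ R (@lebesgue R n) _ mOm (eta * c) => <-.
apply: le_Rintegral => //.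
- exact: integrable_abse iB.
- apply: (@measurable_bounded_integrable _ _ R (@lebesgue R n) _ _ mOm Omfin).
    exact: measurable_cst.
  by exists `|eta * c|; split => // M /ltW HM y _.
- move=> y Omy; rewrite -mulrBl normrM ler_pM//; first exact: dist.
  exact: phic.
Qed.

End kernel_integral.

(** * Uniform continuity and coordinatewise mean values *)
Section uniform_continuity.
Context {R : realType} {T : pseudoMetricType R} {V : normedModType R}.

Lemma compact_unif_continuous (A : set T) (f : T -> V) :
  compact A -> {within A, continuous f} ->
  forall e, 0 < e -> exists2 dl : R, 0 < dl &
    forall x y, A x -> A y -> ball x dl y -> `|f x - f y| <= e.
Proof.
move=> /compact_near_coveringP cA /subspace_continuousP cf e e0.
have := cA R (0^'+) (fun dl x => A x -> forall y, A y -> ball x dl y -> `|f x - f y| <= e) _.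
have e20 : 0 < e / 2 by rewrite divr_gt0.
case=> [x Ax|d /= d0 Hd].
  have /cvgrPdist_lt/(_ _ e20) := cf x Ax.
  rewrite near_withinE => /nbhs_ballP[r /= r0 Hr].
  have r20 : 0 < r / 2 by rewrite divr_gt0.
  exists (ball x (r / 2), [set dl | dl < r / 2]) => /=.
    split; first exact: nbhsx_ballx.
    exact: nbhs_right_lt.
  move=> [z dl] [/= xz dlr] Az y Ay zy.
  have xy : ball x r y.
    by rewrite (splitr r); apply: ball_triangle xz _; exact: le_ball (ltW dlr) _ zy.
  have xz' : ball x r z by apply: le_ball xz; rewrite ler_pdivrMr// ler_pMr// ler1n.
  have := Hr _ xz' Az; have := Hr _ xy Ay => H1 H2.
  rewrite -(subrK (f x) (f z)) -addrA (le_trans (ler_normD _ _))//.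
  by rewrite (splitr e) lerD// ltW// distrC.
exists (d / 2); first by rewrite divr_gt0.
move=> x y Ax Ay xy; apply: (Hd (d / 2)) => //=; last by rewrite divr_gt0.
by rewrite sub0r normrN gtr0_norm ?divr_gt0// ltr_pdivrMr// ltr_pMr// ltr1n.
Qed.

End uniform_continuity.

Section coordinatewise.
Context {R : realType} {m : nat}.
Implicit Types (f : 'rV[R]_m -> R) (a b v : 'rV[R]_m).

Definition set_coord a (j : 'I_m) (s : R) : 'rV[R]_m :=
  \row_l (if l == j then s else a 0 l).

Lemma set_coordD a j s h : set_coord a j (h + s) = h *: unit_rV j + set_coord a j s.
Proof.
by apply/rowP => l; rewrite !mxE eqxx/=; case: eqP => _; rewrite ?mulr1 ?mulr0 ?add0r.
Qed.

Lemma set_coord_derivable f a j s : derivable f (set_coord a j s) (unit_rV j) ->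
  is_derive s 1 (fun r => f (set_coord a j r)) ('D_(unit_rV j) f (set_coord a j s)).
Proof.
have E : (fun h : R => h^-1 *: (f (set_coord a j (h *: (1:R) + s)) - f (set_coord a j s))) =
    (fun h : R => h^-1 *: (f (h *: unit_rV j + set_coord a j s) - f (set_coord a j s))).
  by apply/funext => h; rewrite set_coordD [h *: 1]mulr1.
move=> df; apply: DeriveDef; first by rewrite /derivable E.
by rewrite /derive E.
Qed.

Lemma set_coord_MVT f a j s0 s1 : s0 <= s1 ->
  (forall b, derivable f b (unit_rV j)) -> exists2 c, s0 <= c <= s1 &
  f (set_coord a j s1) - f (set_coord a j s0) =
    'D_(unit_rV j) f (set_coord a j c) * (s1 - s0).
Proof.
move=> s01 df.
have dh (s : R) : is_derive s 1 (fun r => f (set_coord a j r))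
    ('D_(unit_rV j) f (set_coord a j s)) by exact: set_coord_derivable.
have [|c] := @MVT_segment R (fun r => f (set_coord a j r))
    (fun r => 'D_(unit_rV j) f (set_coord a j r)) s0 s1 s01.
- apply: continuous_subspaceT => x; apply/differentiable_continuous/derivable1_diffP.
  by have [] := dh x.
- by rewrite in_itv /= => ? ?; exists c.
Qed.

(** Only partial derivatives are assumed to exist, so the mean value theorem is
    applied along the path from [a] to [b] that changes one coordinate at a time;
    this path stays in the order interval because it is a box. *)
Lemma coordinate_mean_value f v a b :
  (forall c j, derivable f c (unit_rV j)) -> order_interval v a -> order_interval v b ->
  exists2 xi : 'I_m -> 'rV[R]_m, (forall j, order_interval v (xi j)) &
    f b - f a = \sum_j 'D_(unit_rV j) f (xi j) * (b 0 j - a 0 j).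
Proof.
move=> df [a0 av] [b0 bv].
pose c (k : nat) : 'rV[R]_m := \row_(l < m) (if (l < k)%N then b 0 l else a 0 l).
have step (j : 'I_m) : exists2 xi, order_interval v xi &
    f (c j.+1) - f (c j) = 'D_(unit_rV j) f xi * (b 0 j - a 0 j).
  have cS : c j.+1 = set_coord (c j) j (b 0 j).
    apply/rowP => l; rewrite !mxE ltnS leq_eqVlt.
    by case: (eqVneq l j) => [->|lj]; rewrite ?eqxx// (negbTE (_ : (l : nat) != j)).
  have cj : c j = set_coord (c j) j (a 0 j).
    by apply/rowP => l; rewrite !mxE; case: (eqVneq l j) => [->|//]; rewrite ltnn.
  have box s : 0 <= s <= v 0 j -> order_interval v (set_coord (c j) j s).
    move=> /andP[s0 sv]; split=> l; rewrite !mxE; case: (eqVneq l j) => [E|_]; rewrite ?E//.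
      by case: ifP => _; [have := b0 l|have := a0 l]; rewrite mxE.
    by case: ifP.
  have := a0 j; have := b0 j; rewrite !mxE => bj0 aj0.
  have [ab|/ltW ba] := leP (a 0 j) (b 0 j).
    have [s /andP[as_ sb] E] := set_coord_MVT (c j) ab (df^~ j).
    exists (set_coord (c j) j s); last by rewrite cS [in X in _ - f X]cj E.
    by apply: box; rewrite (le_trans aj0)//= (le_trans sb).
  have [s /andP[bs sa] E] := set_coord_MVT (c j) ba (df^~ j).
  exists (set_coord (c j) j s).
    by apply: box; rewrite (le_trans bj0)//= (le_trans sa).
  by rewrite cS [in X in _ - f X]cj -[LHS]opprB E -mulrN opprB.
have [xi xibox xiE] : exists2 xi : 'I_m -> 'rV[R]_m, (forall j, order_interval v (xi j)) &
    forall j : 'I_m, f (c j.+1) - f (c j) = 'D_(unit_rV j) f (xi j) * (b 0 j - a 0 j).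
  have step' (j : 'I_m) : exists xi, order_interval v xi /\
    f (c j.+1) - f (c j) = 'D_(unit_rV j) f xi * (b 0 j - a 0 j).
    by have [xi] := step j; exists xi.
  have [xi H] := choice step'.
  by exists xi => j; have [] := H j.
exists xi => //.
have bE : b = c m by apply/rowP => l; rewrite mxE ltn_ord.
have aE : a = c 0%N by apply/rowP => l; rewrite mxE.
transitivity (f (c m) - f (c 0%N)); first by rewrite -bE -aE.
rewrite -(telescope_sumr (fun k => f (c k)) (leq0n m)) big_mkord.
by apply: eq_bigr => j _; rewrite xiE.
Qed.

End coordinatewise.

(** * Norms, order intervals and the state space *)
Section preliminaries.
Context {R : realType} {n m : nat}.
Implicit Types (Om : set 'rV[R]_n) (v u : 'rV[R]_m).

Lemma normr_rV_le (k : nat) (x : 'rV[R]_k) r : 0 <= r ->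
  (`|x| <= r) = [forall i, `|x 0 i| <= r].
Proof.
move=> r0; rewrite [X in X <= _]/Num.Def.normr/= mx_normrE.
apply/bigmax_leP/forallP => [[_ H] i|H]; first exact: (H (0, i)).
by split => // -[i j] _ /=; rewrite ord1.
Qed.

Lemma normr_coord_le (k : nat) (x : 'rV[R]_k) i : `|x 0 i| <= `|x|.
Proof. by have := normr_rV_le x (normr_ge0 x); rewrite lexx => /esym/forallP. Qed.

Lemma order_intervalE v u : order_interval v u <-> forall i, 0 <= u 0 i <= v 0 i.
Proof.
split=> [[u0 uv] i|H]; first by have := u0 i; rewrite mxE => ->; rewrite uv.
by split=> i; rewrite ?mxE; have /andP[] := H i.
Qed.

Lemma compact_order_interval v : compact (order_interval v).
Proof.
have := @rV_compact R _ (fun i => `[0, v 0 i]%classic) (fun i => @segment_compact _ _ _).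
congr compact; apply/seteqP; split=> u /=.
  by move=> H; apply/order_intervalE => i; have := H i; rewrite in_itv.
by move=> /order_intervalE H i; rewrite in_itv/=; exact: H.
Qed.

Lemma closed_norm_le (k : nat) (r : R) : closed [set x : 'rV[R]_k | `|x| <= r].
Proof.
have := @closed_comp _ _ (fun x : 'rV[R]_k => `|x|) [set y : R | y <= r].
apply; last exact: closed_le.
by move=> x _; exact: norm_continuous.
Qed.

Lemma compact_norm_le (k : nat) (r : R) : compact [set x : 'rV[R]_k | `|x| <= r].
Proof.
apply: bounded_closed_compact.
  exists r; split; first exact: num_real.
  by move=> M rM x /= xr; rewrite (le_trans xr)// ltW.
exact: closed_norm_le.
Qed.

Lemma closure_norm_le Om : bounded_set Om ->
  exists M : R, forall x, closure Om x -> `|x| <= M.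
Proof.
move=> [M [Mr HM]]; exists (M + 1).
have sub : Om `<=` [set x | `|x| <= M + 1].
  by move=> x Omx; apply: (HM _ _ x Omx); rewrite ltrDl.
by move=> x /(closure_subset sub); exact: closed_norm_le.
Qed.

Lemma compact_closure_bounded Om : bounded_set Om -> compact (closure Om).
Proof.
move=> /closure_norm_le[M HM].
exact: (subclosed_compact (@closed_closure _ _) (@compact_norm_le n M)).
Qed.

(** The order interval bounds the functions, which leaves measurability and
    coordinatewise inequalities. *)
Lemma hatX_plusP Om v (phi : 'rV[R]_n -> 'rV[R]_m) : hatX_plus Om v phi <->
  (forall i, lebesgue_measurable_fun (closure Om) (fun x => phi x 0 i)) /\
  (forall x, closure Om x -> forall i, 0 <= phi x 0 i <= v 0 i).
Proof.
split=> [[[_ mphi] box]|[mphi box]].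
  by split=> // x /box /order_intervalE.
split; last by move=> x /box H; exact/order_intervalE.
split=> //; exists `|v|; split; first exact: num_real.
move=> M vM x /box H /=; rewrite normr_rV_le; last by rewrite (le_trans _ (ltW vM)).
apply/forallP => i; have /andP[p0 pv] := H i.
rewrite ger0_norm// (le_trans pv)// (le_trans _ (ltW vM))//.
by rewrite (le_trans _ (normr_coord_le v i))// ler_norm.
Qed.

End preliminaries.

(** * The reaction term *)
Section reaction.
Context {R : realType} {n m : nat}.
Variables (Om : set 'rV[R]_n) (v : 'rV[R]_m) (g : R -> 'rV[R]_n -> 'rV[R]_m -> 'rV[R]_m).
Hypotheses (hbnd : bounded_set Om) (hg : C001 Om g).

Local Notation states T :=
  (`[0, T]%classic `*` closure Om `*` order_interval v : set (R * 'rV[R]_n * 'rV[R]_m)).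

Let compact_states (T : R) : compact (states T).
Proof.
apply: compact_setX; last exact: compact_order_interval.
by apply: compact_setX; [exact: segment_compact|exact: compact_closure_bounded].
Qed.

Let continuous_states (T : R) (W : normedModType R) (f : R * 'rV[R]_n * 'rV[R]_m -> W) :
  {within [set p | closure Om p.1.2], continuous f} -> {within states T, continuous f}.
Proof. by apply: continuous_subspaceW => p [[]]. Qed.

Lemma reaction_partial_bounded T : exists2 L, 0 < L & forall t x u i j,
  0 <= t <= T -> closure Om x -> order_interval v u ->
  `|'D_(unit_rV j) (fun b => g t x b 0 i) u| <= L.
Proof.
have [_ _ cp] := hg.
have := continuous_compact (continuous_states cp) (compact_states (T := T)).
move=> /compact_bounded[M [Mr HM]]; exists (`|M| + 1); first by rewrite ltr_wpDl.
move=> t x u i j tT clx boxu.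
have : `|partial_mx (g t x) u| <= `|M| + 1.
  apply: HM; first by rewrite ltr_pwDr// ler_norm.
  by exists (t, x, u) => //; split => //; split => //=; rewrite in_itv.
apply: le_trans; rewrite [leRHS]/Num.Def.normr/= mx_normrE.
by apply/bigmax_geP; right; exists (i, j) => //=; rewrite mxE.
Qed.

Lemma reaction_derivable t x i u j : closure Om x ->
  derivable (fun b => g t x b 0 i) u (unit_rV j).
Proof. by have [_ + _] := hg; apply. Qed.

Lemma reaction_lipschitz T : exists2 L, 0 < L & forall t x u w r i,
  0 <= t <= T -> closure Om x -> order_interval v u -> order_interval v w ->
  (forall j, `|u 0 j - w 0 j| <= r) -> `|g t x u 0 i - g t x w 0 i| <= L * r.
Proof.
have [L L0 HL] := reaction_partial_bounded T.
exists (m%:R * L + 1); first by rewrite ltr_wpDl// mulr_ge0// ltW.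
move=> t x u w r i tT clx boxu boxw uw.
have r0 : 0 <= r by exact: le_trans (uw i).
have [xi boxxi ->] := coordinate_mean_value
  (fun c j => @reaction_derivable t x i c j clx) boxw boxu.
rewrite (le_trans (ler_norm_sum _ _ _))// (@le_trans _ _ (\sum_(j < m) L * r))//.
  by apply: ler_sum => j _; rewrite normrM ler_pM// HL.
by rewrite sumr_const card_ord -[leLHS]mulr_natl mulrA ler_wpM2r// lerDl.
Qed.

Lemma reaction_equicontinuous T e : 0 < e -> exists2 dl, 0 < dl & forall s t x u i,
  0 <= s <= T -> 0 <= t <= T -> `|s - t| <= dl -> closure Om x -> order_interval v u ->
  `|g s x u 0 i - g t x u 0 i| <= e.
Proof.
move=> e0; have [cg _ _] := hg.
have [dl dl0 H] := compact_unif_continuous (compact_states (T := T)) (continuous_states cg) e0.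
exists (dl / 2); first by rewrite divr_gt0.
move=> s t x u i sT tT st clx boxu.
have := H (s, x, u) (t, x, u).
have memT r : 0 <= r <= T -> states T (r, x, u).
  by move=> rT; split => //; split => //=; rewrite in_itv.
move=> /(_ (memT _ sT) (memT _ tT)) {}H.
apply: le_trans (H _); last first.
  split; last exact: ballxx.
  split; last exact: ballxx.
  by rewrite /ball/= (le_lt_trans st)// ltr_pdivrMr// ltr_pMr// ltr1n.
by apply: le_trans (normr_coord_le _ i); rewrite !mxE.
Qed.

(** The superposition is a continuous function of the measurable vector
    [row_mx x (phi x)]. *)
Lemma measurable_reaction t i (phi : 'rV[R]_n -> 'rV[R]_m) :
  (forall j, lebesgue_measurable_fun (closure Om) (fun x => phi x 0 j)) ->
  lebesgue_measurable_fun (closure Om) (fun x => g t x (phi x) 0 i).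
Proof.
move=> mphi; have [cg _ _] := hg.
have mcl : measurable (closure Om : set (lebesgue_rV R n)).
  exact/closed_lebesgue_measurable/closed_closure.
pose psi (x : lebesgue_rV R n) : 'rV[R]_(n + m) := row_mx x (phi x).
have mpsi l : measurable_fun (closure Om : set (lebesgue_rV R n))
    (fun x => psi x 0 l : measurableTypeR R).
  case: (split_ordP l) => j ->.
    under eq_fun do rewrite /psi row_mxEl.
    exact: measurable_funS (measurable_coord j).
  under eq_fun do rewrite /psi row_mxEr.
  exact: mphi.
pose D := [set z : 'rV[R]_(n + m) | closure Om (lsubmx z)].
have psiD x : closure Om x -> D (psi x) by rewrite /D /psi /= row_mxKl.
pose H (z : 'rV[R]_(n + m)) := g t (lsubmx z) (rsubmx z) 0 i.
have cH : {within D, continuous H}.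
  apply/subspace_continuousP => z Dz; rewrite /H.
  move/subspace_continuousP : cg => /(_ (t, lsubmx z, rsubmx z) Dz) cg.
  pose q (z : 'rV[R]_(n + m)) := (t, lsubmx z, rsubmx z).
  have cq : q @ within D (nbhs z) --> within [set p | closure Om p.1.2] (nbhs (q z)).
    have cq0 : q @ z --> q z.
      have c1 : (fun y : 'rV[R]_(n + m) => (t, lsubmx y)) @ z --> (t, lsubmx z).
        apply: (@cvg_pair _ _ _ (nbhs z) (nbhs t) (nbhs (lsubmx z)));
          [exact: cvg_cst|exact: continuous_lsubmx].
      apply: (@cvg_pair _ _ _ (nbhs z) (nbhs (t, lsubmx z)) (nbhs (rsubmx z)));
        [exact: c1|exact: continuous_rsubmx].
    move=> B HB; have := cq0 _ HB.
    change (nbhs z [set y | closure Om (lsubmx y) -> B (q y)] ->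
      nbhs z [set y | D y -> B (q y)]).
    by apply: filterS => y; exact.
  exact: (cvg_comp _ _ (cvg_comp _ _ cq cg) (@coord_continuous _ _ _ 0 i _)).
have := measurable_fun_continuous_comp mcl mpsi psiD cH.
by apply: eq_measurable_fun => x _; rewrite /H /psi row_mxKl row_mxKr.
Qed.

Hypotheses (hcoop : forall t x u, closure Om x -> 0 <= t -> order_interval v u ->
    cooperative (partial_mx (g t x) u))
  (hg0 : forall i t x, 0 <= t -> closure Om x -> g t x 0 0 i = 0)
  (hgv : forall i t x u, 0 <= t -> closure Om x -> order_interval v u ->
    u 0 i = v 0 i -> g t x u 0 i <= 0).

(** The reaction term points into the order interval on its faces, with a linear
    rate inside.  Lower bound: in the mean value formula between [0] and [u] the
    off-diagonal terms are nonnegative by cooperativity, and [g(t, x, 0) = 0].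
    Upper bound: moving the [i]-th coordinate of [u] up to [v_i] changes [g_i] by
    at most [L (v_i - u_i)] and leads to a point where [g_i <= 0]. *)
Lemma reaction_tangency T : exists2 L, 0 < L & forall t x u i,
  0 <= t <= T -> closure Om x -> order_interval v u ->
  - (L * u 0 i) <= g t x u 0 i <= L * (v 0 i - u 0 i).
Proof.
have [L L0 HL] := reaction_partial_bounded T.
exists L => // t x u i tT clx boxu; have /andP[t0 _] := tT.
have uv j : 0 <= u 0 j <= v 0 j by move/order_intervalE : boxu.
have df c j := @reaction_derivable t x i c j clx.
apply/andP; split.
  have box0 : order_interval v 0.
    by apply/order_intervalE => j; rewrite mxE lexx/=; have /andP[/le_trans] := uv j; apply.
  have [xi boxxi] := coordinate_mean_value df box0 boxu.
  rewrite hg0// subr0 => ->; rewrite (bigD1 i)//= -[leLHS]addr0 lerD//.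
    rewrite mxE subr0 -mulNr ler_wpM2r//; first by have /andP[] := uv i.
    by have := HL t x (xi i) i i tT clx (boxxi i); rewrite ler_norml => /andP[].
  apply: sumr_ge0 => j ji; rewrite mxE subr0 mulr_ge0//.
    by have := hcoop clx t0 (boxxi j) (i := i) (j := j); rewrite mxE eq_sym => /(_ ji).
  by have /andP[] := uv j.
have boxw : order_interval v (set_coord u i (v 0 i)).
  apply/order_intervalE => j; rewrite mxE; case: eqVneq => [->|_]; last exact: uv.
  by rewrite lexx andbT; have /andP[/le_trans] := uv i; apply.
have [xi boxxi] := coordinate_mean_value df boxu boxw.
rewrite (bigD1 i)//= [X in _ = _ + X]big1 => [|j ji]; last first.
  by rewrite mxE (negbTE ji) subrr mulr0.
rewrite mxE eqxx addr0 => E.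
have gw : g t x (set_coord u i (v 0 i)) 0 i <= 0 by apply: hgv => //; rewrite mxE eqxx.
have : - L <= 'D_(unit_rV i) (fun b => g t x b 0 i) (xi i).
  by have := HL t x (xi i) i i tT clx (boxxi i); rewrite ler_norml => /andP[].
have vu : 0 <= v 0 i - u 0 i by rewrite subr_ge0; have /andP[] := uv i.
move=> /(ler_wpM2r vu); rewrite -E; lra.
Qed.

End reaction.

(** * The right-hand side as a field on states *)
Section field.
Context {R : realType} {n m : nat}.
Variables (Om : set 'rV[R]_n) (v : 'rV[R]_m) (d : 'I_m -> R)
  (K : 'I_m -> R -> 'rV[R]_n -> R) (g : R -> 'rV[R]_n -> 'rV[R]_m -> 'rV[R]_m).

(** Vector-valued functions of [x] are treated as scalar functions of the pair
    [(x, i)]: the max norm on vectors makes the sup norms agree, and scalar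
    estimates suffice. *)
Definition row_of (psi : 'rV[R]_n * 'I_m -> R) (x : 'rV[R]_n) : 'rV[R]_m :=
  \row_i psi (x, i).

Definition rhs_field t psi (p : 'rV[R]_n * 'I_m) : R :=
  nonlocal_rhs Om d K g (fun=> row_of psi) t p.1 0 p.2.

Definition state_set : set ('rV[R]_n * 'I_m -> R) :=
  [set psi | hatX_plus Om v (row_of psi)].

Definition components : set ('rV[R]_n * 'I_m) := [set p | closure Om p.1].

Lemma rhs_fieldE t psi x i : rhs_field t psi (x, i) =
  d i * kernel_integral Om (K i t) (fun y => psi (y, i)) x - d i * psi (x, i) +
  g t x (row_of psi x) 0 i.
Proof.
rewrite /rhs_field /nonlocal_rhs !mxE /=; congr (d i * _ - _ + _).
by apply: eq_Rintegral => y _; rewrite mxE.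
Qed.

Lemma state_setP psi : state_set psi <->
  (forall i, lebesgue_measurable_fun (closure Om) (fun x => psi (x, i))) /\
  (forall x, closure Om x -> forall i, 0 <= psi (x, i) <= v 0 i).
Proof.
rewrite /state_set /= hatX_plusP; split=> -[mpsi box]; split.
- move=> i; have := mpsi i; by under eq_fun do rewrite mxE.
- by move=> x clx i; have := box x clx i; rewrite mxE.
- move=> i; under eq_fun do rewrite mxE; exact: mpsi.
- by move=> x clx i; rewrite mxE; exact: box.
Qed.

Lemma state_row_interval psi x : state_set psi -> closure Om x ->
  order_interval v (row_of psi x).
Proof. by move=> [_ H] /H. Qed.

(** Uniform limits on the closure preserve measurability there, being pointwise
    limits of sequences, and the bounds [0] and [v]. *)
Lemma state_set_unif_closed : unif_closed components state_set.
Proof.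
move=> phi lim_phi; have approx (N : nat) : exists psi, state_set psi /\
    udist_le components N.+1%:R^-1 phi psi.
  by have [//|psi] := lim_phi N.+1%:R^-1; exists psi.
have [P HP] := choice approx; apply/state_setP; split=> [i|x clx i].
  apply: (@measurable_fun_cvg _ (lebesgue_rV R n) R (closure Om)
      (fun N (x : lebesgue_rV R n) => P N (x, i))).
    by move=> N; have [/state_setP[mP _] _] := HP N; exact: mP.
  move=> x clx; apply/cvgrPdist_le => e e0.
  near=> N; have [_ dist] := HP N.
  rewrite (le_trans (dist (x, i) clx))// ltW//.
  by near: N; exact: (near_infty_natSinv_lt (PosNum e0)).
suff H e : 0 < e -> - e <= phi (x, i) <= v 0 i + e.
  by apply/andP; split; apply/ler_addgt0Pr => e e0; have /andP[? ?] := H e e0; lra.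
move=> e0; have [psi /state_setP[_ box] dist] := lim_phi e e0.
have := dist (x, i) clx; have /andP[? ?] := box x clx i.
by rewrite ler_norml => /andP[? ?]; apply/andP; split; lra.
Unshelve. all: by end_near. Qed.


Hypotheses (oOm : open Om) (hbnd : bounded_set Om) (hd : forall i, 0 < d i)
  (hv : forall i, 0 <= v 0 i)
  (hK : forall i t, prob_kernel (K i t))
  (hKcont : forall i, continuous (fun p : R * 'rV[R]_n => K i p.1 p.2))
  (hg : C001 Om g).

Let mcl : measurable (closure Om : set (lebesgue_rV R n)).
Proof. exact/closed_lebesgue_measurable/closed_closure. Qed.

Lemma state_measurable psi i : state_set psi ->
  lebesgue_measurable_fun Om (fun x => psi (x, i)).
Proof.
move=> /state_setP[mpsi _].
exact: (measurable_funS mcl (@subset_closure _ Om) (mpsi i)).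
Qed.

Lemma state_bound psi i : state_set psi -> forall y, Om y -> `|psi (y, i)| <= v 0 i.
Proof.
move=> /state_setP[_ box] y Omy.
by have /andP[? ?] := box y (subset_closure Omy) i; rewrite ger0_norm.
Qed.

Lemma kernel_unif_continuous T e : 0 < e -> exists2 dl, 0 < dl &
  forall i s t x x' y, 0 <= s <= T -> 0 <= t <= T -> closure Om x -> closure Om x' ->
    Om y -> `|s - t| <= dl -> `|x - x'| <= dl ->
    `|K i s (x - y) - K i t (x' - y)| <= e.
Proof.
move=> e0; have [M HM] := closure_norm_le hbnd.
pose dom := `[0, T]%classic `*` [set z : 'rV[R]_n | `|z| <= M + M].
have cdom : compact dom.
  by apply: compact_setX; [exact: segment_compact|exact: compact_norm_le].
have unif i : exists dl, 0 < dl /\ forall p q, dom p -> dom q -> ball p dl q ->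
    `|K i p.1 p.2 - K i q.1 q.2| <= e.
  have [dl dl0 H] := compact_unif_continuous cdom (continuous_subspaceT (hKcont (i := i))) e0.
  by exists dl; split => // p q dp dq pq; exact: H.
have [dl Hdl] := choice unif.
pose dm := \big[Num.min/1]_i dl i.
have dm0 : 0 < dm by apply/bigmin_gtP; split => // i _; have [] := Hdl i.
exists (dm / 2); first by rewrite divr_gt0.
move=> i s t x x' y sT tT clx clx' Omy st xx'.
have small a : a <= dm / 2 -> a < dl i.
  move=> /le_lt_trans; apply; rewrite (@lt_le_trans _ _ dm)//.
    by rewrite ltr_pdivrMr// ltr_pMr// ltr1n.
  exact: bigmin_le.
have inM z : closure Om z -> `|z - y| <= M + M.
  move=> clz; rewrite (le_trans (ler_normB _ _))// lerD// HM//.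
  exact: subset_closure.
have [_ H] := Hdl i.
apply: (H (s, x - y) (t, x' - y)).
- by split => /=; [rewrite in_itv|exact: inM].
- by split => /=; [rewrite in_itv|exact: inM].
split; rewrite /=; first by rewrite /ball/=; exact: small.
rewrite mx_norm_ball /ball_ /= opprB addrA subrK; exact: small.
Qed.

(** The nonlocal term is continuous in [x], by uniform continuity of the kernel. *)
Lemma rhs_measurable t psi i : 0 <= t -> state_set psi ->
  lebesgue_measurable_fun (closure Om) (fun x => rhs_field t psi (x, i)).
Proof.
move=> t0 Spsi; have [mpsi _] := (state_setP psi).1 Spsi.
rewrite (_ : (fun x => _) = (fun x => d i * kernel_integral Om (K i t) (fun y => psi (y, i)) x
   - d i * psi (x, i) + g t x (row_of psi x) 0 i)); last first.
  by apply/funext => x; rewrite rhs_fieldE.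
have mreact : lebesgue_measurable_fun (closure Om) (fun x => g t x (row_of psi x) 0 i).
  by apply: measurable_reaction => // j; under eq_fun do rewrite mxE; exact: mpsi.
suff mint : lebesgue_measurable_fun (closure Om)
    (kernel_integral Om (K i t) (fun y => psi (y, i))).
  have mcst : lebesgue_measurable_fun (closure Om) (fun=> d i) by exact: measurable_cst.
  have m1 := measurable_funM mcst mint; have m2 := measurable_funM mcst (mpsi i).
  exact: (measurable_funD (measurable_funB m1 m2) mreact).
apply: (continuous_lebesgue_measurable mcl).
apply/subspace_continuousP => x clx; apply/cvgrPdist_le => e e0.
pose c := v 0 i * fine (@lebesgue_outer R n Om).
have c0 : 0 <= c by rewrite mulr_ge0 ?fine_ge0 ?lebesgue_outer_ge0.
have ec0 : 0 < e / (c + 1) by rewrite divr_gt0// ltr_wpDl.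
have [dl dl0 Hdl] := kernel_unif_continuous t ec0.
have near_x : \forall x' \near x, `|x - x'| <= dl.
  by have := nbhsx_ballx x dl dl0; apply: filterS => z; rewrite mx_norm_ball => /ltW.
rewrite near_withinE; near=> x' => clx'.
apply: (@le_trans _ _ (e / (c + 1) * v 0 i * fine (@lebesgue_outer R n Om))).
  apply: kernel_integral_dist_kernel => //.
  - exact: lebesgue_bounded_fin.
  - exact: state_measurable.
  - exact: state_bound.
  - move=> y Omy; have tt : 0 <= t <= t by rewrite t0 lexx.
    have tdl : `|t - t| <= dl by rewrite subrr normr0 ltW.
    by apply: (Hdl _ _ _ _ _ _ tt tt) => //; near: x'.
  - exact: ltW.
rewrite -mulrA -/c mulrAC ler_pdivrMr ?ltr_wpDl// ler_wpM2l ?(ltW e0)// lerDl.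
Unshelve. all: by end_near. Qed.

Hypotheses
  (hcoop : forall t x u, closure Om x -> 0 <= t -> order_interval v u ->
    cooperative (partial_mx (g t x) u))
  (hg0 : forall i t x, 0 <= t -> closure Om x -> g t x 0 0 i = 0)
  (hgv : forall i t x u, 0 <= t -> closure Om x -> order_interval v u ->
    u 0 i = v 0 i -> g t x u 0 i <= 0).

Let dsum := \sum_i d i.

Let d_le i : d i <= dsum.
Proof.
rewrite /dsum (bigD1 i)//= lerDl; apply: sumr_ge0 => j _; exact: ltW.
Qed.

Let dsum_ge0 : 0 <= dsum.
Proof. by apply: sumr_ge0 => j _; exact: ltW. Qed.

Let state_box psi x i : state_set psi -> closure Om x -> 0 <= psi (x, i) <= v 0 i.
Proof. by move=> /state_setP[_ box] clx; exact: box. Qed.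

Lemma rhs_lipschitz T :
  exists2 L, 0 < L & lipschitz_upto components state_set rhs_field T L.
Proof.
have [L L0 HL] := reaction_lipschitz v hbnd hg T.
exists (2 * dsum + L); first by rewrite ltr_wpDl// mulr_ge0.
move=> t phi psi r tT Sphi Spsi dist [x i] clx.
have r0 : 0 <= r by exact: le_trans (dist (x, i) clx).
rewrite !rhs_fieldE.
have H1 := dist (x, i) clx.
have H2 : `|g t x (row_of phi x) 0 i - g t x (row_of psi x) 0 i| <= L * r.
  apply: HL => //; try exact: state_row_interval.
  by move=> j; rewrite !mxE; exact: dist.
have H3 : `|kernel_integral Om (K i t) (fun y => phi (y, i)) x -
    kernel_integral Om (K i t) (fun y => psi (y, i)) x| <= r.
  apply: (kernel_integral_dist x oOm (hK i t) (state_measurable i Sphi)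
    (state_bound i Sphi) (state_measurable i Spsi) (state_bound i Spsi) r0).
  by move=> y Omy; apply: dist; exact: subset_closure.
move: H1 H2 H3; set a := kernel_integral _ _ _ _; set b := kernel_integral _ _ _ _.
set p := phi _; set q := psi _; set ga := g _ _ _ _ _; set gb := g _ _ _ _ _ => H1 H2 H3.
rewrite [X in `|X|](_ : _ = d i * (a - b) - d i * (p - q) + (ga - gb)); last by ring.
have d0 : 0 <= d i by exact: ltW.
have H4 : `|d i * (a - b)| <= dsum * r by rewrite normrM ger0_norm// ler_pM.
have H5 : `|d i * (p - q)| <= dsum * r by rewrite normrM ger0_norm// ler_pM.
move: H2 H4 H5; rewrite !ler_norml => /andP[? ?] /andP[? ?] /andP[? ?].
by apply/andP; split; lra.
Qed.

(** The average of [psi] against a kernel of mass at most [1] lies between [0] and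
    [v_i], so that the dispersal term obeys bounds of the same form as the
    reaction term. *)
Lemma rhs_tangency T : exists2 L, 0 < L & forall t psi x i, 0 <= t <= T ->
  state_set psi -> closure Om x ->
  - (L * psi (x, i)) <= rhs_field t psi (x, i) <= L * (v 0 i - psi (x, i)).
Proof.
have [L L0 HL] := reaction_tangency hbnd hg hcoop hg0 hgv T.
exists (dsum + L); first by rewrite ltr_wpDl.
move=> t psi x i tT Spsi clx; rewrite rhs_fieldE.
have := HL t x (row_of psi x) i tT clx (state_row_interval Spsi clx).
rewrite mxE; set q := psi _ => /andP[g1 g2].
have /andP[q0 qv] := state_box i Spsi clx; rewrite -/q in q0 qv.
have k0 : 0 <= kernel_integral Om (K i t) (fun y => psi (y, i)) x.
  apply: kernel_integral_ge0 => // y /subset_closure cly.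
  by have /andP[] := state_box i Spsi cly.
have kv : kernel_integral Om (K i t) (fun y => psi (y, i)) x <= v 0 i.
  apply: (kernel_integral_le x oOm (hK i t) (state_measurable i Spsi)) => //.
  by move=> y /subset_closure cly; exact: state_box.
move: (kernel_integral _ _ _ _) k0 kv (g _ _ _ _ _) g1 g2 => k k0 kv gg g1 g2.
have h1 : 0 <= d i * k by rewrite mulr_ge0// ltW.
have h2 : d i * q <= dsum * q by rewrite ler_wpM2r.
have h3 : d i * (k - q) <= d i * (v 0 i - q) by rewrite ler_wpM2l ?(ltW (hd i))//; lra.
have h4 : d i * (v 0 i - q) <= dsum * (v 0 i - q) by rewrite ler_wpM2r// subr_ge0.
by apply/andP; split; lra.
Qed.

Lemma rhs_bounded T : exists B, bounded_upto components state_set rhs_field T B.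
Proof.
have [L L0 HL] := rhs_tangency T.
exists (L * `|v|) => t psi [x i] tT Spsi clx.
have /andP[q0 qv] := state_box i Spsi clx.
have vv : v 0 i <= `|v| by rewrite (le_trans _ (normr_coord_le v i))// ler_norm.
have /andP[h1 h2] := HL t psi x i tT Spsi clx.
rewrite ler_norml; apply/andP; split.
  by rewrite (le_trans _ h1)// lerN2 ler_wpM2l ?(ltW L0)// (le_trans qv).
by rewrite (le_trans h2)// ler_wpM2l ?(ltW L0)//; lra.
Qed.

(** By [rhs_tangency], [psi + h F] lies between [(1 - h L) psi] and
    [v - (1 - h L) (v - psi)]. *)
Lemma rhs_euler_invariant T :
  exists2 h, 0 < h & euler_invariant_upto state_set rhs_field T h.
Proof.
have [L L0 HL] := rhs_tangency T.
exists L^-1; first by rewrite invr_gt0.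
move=> t psi h tT Spsi /andP[h0 hL]; apply/state_setP; split=> [i|x clx i].
  have /andP[t0 _] := tT; have [mpsi _] := (state_setP psi).1 Spsi.
  have mcst : lebesgue_measurable_fun (closure Om) (fun=> h) by exact: measurable_cst.
  exact: (measurable_funD (mpsi i) (measurable_funM mcst (rhs_measurable i t0 Spsi))).
have /andP[q0 qv] := state_box i Spsi clx.
have /andP[h1 h2] := HL t psi x i tT Spsi clx.
have hL1 : h * L <= 1 by rewrite -ler_pdivlMr// div1r.
have e1 := ler_wpM2l h0 h1; have e2 := ler_wpM2l h0 h2.
have e3 : h * L * psi (x, i) <= psi (x, i) by rewrite ler_piMl.
have e4 : h * L * (v 0 i - psi (x, i)) <= v 0 i - psi (x, i).
  by rewrite ler_piMl// subr_ge0.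
by apply/andP; split; lra.
Qed.

Lemma rhs_equicontinuous T : equicontinuous_upto components state_set rhs_field T.
Proof.
move=> e e0; have e20 : 0 < e / 2 by rewrite divr_gt0.
have [d1 d10 H1] := reaction_equicontinuous v hbnd hg T e20.
pose c := dsum * `|v| * fine (@lebesgue_outer R n Om).
have c0 : 0 <= c by rewrite !mulr_ge0 ?fine_ge0 ?lebesgue_outer_ge0.
have ec0 : 0 < e / 2 / (c + 1) by rewrite divr_gt0// ltr_wpDl.
have [d2 d20 H2] := kernel_unif_continuous T ec0.
exists (Num.min d1 d2); first by rewrite lt_min d10.
move=> s t phi sT tT; rewrite le_min => /andP[st1 st2] Sphi [x i] clx.
rewrite !rhs_fieldE.
have := H1 s t x (row_of phi x) i sT tT st1 clx (state_row_interval Sphi clx).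
have : `|kernel_integral Om (K i s) (fun y => phi (y, i)) x -
    kernel_integral Om (K i t) (fun y => phi (y, i)) x| <=
    e / 2 / (c + 1) * v 0 i * fine (@lebesgue_outer R n Om).
  apply: kernel_integral_dist_kernel => //.
  - exact: lebesgue_bounded_fin.
  - exact: state_measurable.
  - exact: state_bound.
  - by move=> y Omy; apply: (H2 _ _ _ _ _ _ sT tT) => //; rewrite subrr normr0 ltW.
  - exact: ltW.
set a := kernel_integral _ _ _ _; set b := kernel_integral _ _ _ _.
set q := phi _; set ga := g _ _ _ _ _; set gb := g _ _ _ _ _ => h1 h2.
rewrite [X in `|X|](_ : _ = d i * (a - b) + (ga - gb)); last by ring.
rewrite (le_trans (ler_normD _ _))// (splitr e) lerD// normrM (gtr0_norm (hd i)).
apply: (@le_trans _ _ (dsum * (e / 2 / (c + 1) * `|v| * fine (@lebesgue_outer R n Om)))).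
  apply: ler_pM => //; first exact: ltW.
  apply: (le_trans h1); rewrite ler_wpM2r ?fine_ge0 ?lebesgue_outer_ge0//.
  rewrite ler_wpM2l ?(ltW ec0)//.
  by rewrite (le_trans _ (normr_coord_le v i))// ler_norm.
rewrite (_ : dsum * _ = e / 2 / (c + 1) * c); last by rewrite /c; ring.
by rewrite mulrAC ler_pdivrMr ?ltr_wpDl// ler_wpM2l ?(ltW e20)// lerDl.
Qed.

End field.

(** * Existence and uniqueness *)
Section sup_norm.
Context {R : realType} {n m : nat}.
Implicit Types (Om : set 'rV[R]_n) (v : 'rV[R]_m) (phi psi : 'rV[R]_n -> 'rV[R]_m).

Lemma hatX_norm_le Om phi r : closure Om !=set0 ->
  (forall x, closure Om x -> `|phi x| <= r) -> hatX_norm Om phi <= r.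
Proof.
move=> [x0 clx0] H; apply: ge_sup; first by exists `|phi x0|; exists x0.
by move=> _ [x clx <-]; exact: H.
Qed.

(** The order interval provides the bound without which the supremum would carry
    no information. *)
Lemma le_hatX_norm Om v phi psi x : hatX_plus Om v phi -> hatX_plus Om v psi ->
  closure Om x -> `|phi x - psi x| <= hatX_norm Om (fun x => phi x - psi x).
Proof.
move=> /hatX_plusP[_ bphi] /hatX_plusP[_ bpsi] clx; apply: ub_le_sup; last by exists x.
exists `|v| => _ [y cly <-]; rewrite normr_rV_le//; apply/forallP => i; rewrite !mxE.
have := bphi y cly i; have := bpsi y cly i => /andP[? ?] /andP[? ?].
have vi : v 0 i <= `|v| by rewrite (le_trans _ (normr_coord_le v i))// ler_norm.
by rewrite ler_norml; apply/andP; split; lra.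
Qed.

End sup_norm.

Lemma diff_quotient_dist (R : realFieldType) (a h l e : R) : h != 0 ->
  `|a - h * l| <= e * `|h| -> `|l - h^-1 * a| <= e.
Proof.
move=> h0 H; rewrite -(ler_pM2r (_ : 0 < `|h|)) ?normr_gt0// -normrM.
by rewrite mulrBl mulrAC mulVf// mul1r distrC [l * h]mulrC.
Qed.

Unset Implicit Arguments.
Set Strict Implicit.
Theorem proposition3p5 (R : realType) (m n : nat) (hm : (1 <= m)%N)
    (hn : (1 <= n)%N) (Om : set 'rV[R]_n)
    (hdom : domain Om) (hbnd : bounded_set Om) (hsc : simply_connected Om)
    (hsmooth : smooth_boundary Om)
    (d : 'I_m -> R) (hd : forall i, 0 < d i)
    (v : 'rV[R]_m) (hv : ([set a : 'rV[R]_m | le_rV 0 a]°) v)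
    (K : 'I_m -> R -> 'rV[R]_n -> R)
    (hK0 : forall i t x, 0 <= K i t x)
    (hKcont : forall i, continuous (fun p : R * 'rV[R]_n => K i p.1 p.2))
    (hKpos : forall i t, 0 < K i t 0)
    (hKint : forall i t,
       (\int[lebesgue]_(x in [set: lebesgue_rV R n]) (K i t x)%:E)%E = 1%E)
    (g : R -> 'rV[R]_n -> 'rV[R]_m -> 'rV[R]_m)
    (hg : C001 Om g)
    (hcoop : forall t x u, closure Om x -> 0 <= t -> order_interval v u ->
       cooperative (partial_mx (g t x) u))
    (hg0 : forall i t x, 0 <= t -> closure Om x -> g t x 0 0 i = 0)
    (hgv : forall i t x u, 0 <= t -> closure Om x -> order_interval v u ->
       u 0 i = v 0 i -> g t x u 0 i <= 0)
    (u0 : 'rV[R]_n -> 'rV[R]_m) (hu0 : hatX_plus Om v u0) :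
  exists u : R -> 'rV[R]_n -> 'rV[R]_m,
    [/\ solution Om d K g v u0 u,
        (forall t x, 0 <= t -> closure Om x ->
           derivable_Rplus (fun s => u s x) t) &
        forall w, solution Om d K g v u0 w ->
          forall t x, 0 <= t -> closure Om x -> w t x = u t x].
Proof.
have [oOm [x0 Omx0] _] := hdom.
have cl0 : closure Om !=set0 by exists x0; exact: subset_closure.
have v0 i : 0 <= v 0 i.
  by have := interior_subset hv => /= /(_ i); rewrite mxE.
have hK i t : prob_kernel (K i t).
  split=> // x; have ct : {for x, continuous (fun x : 'rV[R]_n => (t, x))}.
    apply: (@cvg_pair _ _ _ (nbhs x) (nbhs t) (nbhs x)); [exact: cvg_cst|exact: cvg_id].
  exact: (continuous_comp ct (hKcont i (t, x))).
pose F := rhs_field Om d K g; pose S := state_set Om v.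
pose A := components Om : set ('rV[R]_n * 'I_m).
have lip T : exists2 L, 0 < L & lipschitz_upto A S F T L by exact: rhs_lipschitz.
have bd T : exists B, bounded_upto A S F T B by exact: rhs_bounded.
have inv T : exists2 h, 0 < h & euler_invariant_upto S F T h by exact: rhs_euler_invariant.
have equi T : equicontinuous_upto A S F T by exact: rhs_equicontinuous.
pose flat (phi : 'rV[R]_n -> 'rV[R]_m) (p : 'rV[R]_n * 'I_m) := phi p.1 0 p.2.
have flatK phi : row_of (flat phi) = phi.
  by apply/funext => x; apply/rowP => i; rewrite mxE.
have Sflat phi : hatX_plus Om v phi -> S (flat phi) by rewrite /S /state_set /= flatK.
have [u [u_0 Su su]] : exists u, [/\ udist_le A 0 (u 0) (flat u0),
    forall t, 0 <= t -> S (u t) & forall T, 0 < T -> strict_sol A F T u].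
  exact: strict_sol_exists (@state_set_unif_closed _ _ _ Om v) (Sflat _ hu0) _ _ _ _.
pose U t := row_of (u t).
have HU t x i : U t x 0 i = u t (x, i) by rewrite mxE.
have rhsU t x i : nonlocal_rhs Om d K g U t x 0 i = F t (u t) (x, i) by [].
(* Difference quotients of [U] converge uniformly in [x]; this gives both the
   derivative for [t > 0] and the one-sided derivative at [0]. *)
have quotient t : 0 <= t -> forall e, 0 < e -> exists2 dl, 0 < dl & forall s x, 0 <= s ->
    s != t -> `|s - t| < dl -> closure Om x ->
    `|nonlocal_rhs Om d K g U t x - (s - t)^-1 *: (U s x - U t x)| <= e.
  move=> t0 e e0; pose T := t + 1; have T0 : 0 < T by rewrite ltr_wpDl.
  have [L L0 lipT] := lip T; have [B bdT] := bd T.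
  have SuT r : 0 <= r <= T -> S (u r) by move=> /andP[r0 _]; exact: Su.
  have [dl dl0 H] := strict_sol_derivative L0 bdT lipT (equi T) SuT (su T T0) e0.
  exists (Num.min 1 dl); first by rewrite lt_min ltr01.
  move=> s x s0 st; rewrite lt_min => /andP[st1 stdl] clx.
  rewrite normr_rV_le ?(ltW e0)//; apply/forallP => i.
  have tT : 0 <= t <= T by rewrite t0 /T lerDl ler01.
  have sT : 0 <= s <= T.
    by move: st1; rewrite s0 ltr_norml => /andP[_ ?]; rewrite /T; lra.
  have Hst := H s t sT tT (ltW stdl) (x, i) clx.
  have coordE (a p q : 'rV[R]_m) (c : R) : (a - c *: (p - q)) 0 i =
      a 0 i - c * (p 0 i - q 0 i) by rewrite !mxE.
  rewrite coordE rhsU !HU; apply: diff_quotient_dist Hst.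
  by rewrite subr_eq0.
have near_dist (t r : R) : 0 < r -> \forall s \near t, `|s - t| < r.
  by move=> r0; have := nbhsx_ballx t r r0; apply: filterS => s; rewrite /ball/= distrC.
exists U; split.
- split.
  + split; first by move=> t t0; exact: Su.
    move=> t t0; apply/cvgrPdist_le => e e0.
    pose T := t + 1; have T0 : 0 < T by rewrite ltr_wpDl.
    have [B bdT] := bd T.
    have SuT r : 0 <= r <= T -> S (u r) by move=> /andP[r0 _]; exact: Su.
    have [dl dl0 H] := strict_sol_lipschitz bdT SuT (su T T0).
    have C0 : 0 < `|B| + 1 by rewrite ltr_wpDl.
    have near_t : \forall s \near t, `|s - t| < Num.min 1 (Num.min dl (e / (`|B| + 1))).
      by apply: near_dist; rewrite !lt_min ltr01 dl0 divr_gt0.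
    rewrite near_withinE; apply: filterS near_t => s.
    rewrite !lt_min => /and3P[st1 stdl ste] s0.
    rewrite sub0r normrN ger0_norm; last first.
      have [x clx] := cl0.
      exact: le_trans (le_hatX_norm (Su s s0) (Su t t0) clx).
    apply: hatX_norm_le => // x clx; rewrite normr_rV_le ?(ltW e0)//.
    apply/forallP => i; rewrite !mxE.
    have tT : 0 <= t <= T by rewrite t0 /T lerDl ler01.
    have sT : 0 <= s <= T.
      by move: st1; rewrite /Rplus/= in s0; rewrite s0 ltr_norml => /andP[_ ?]; rewrite /T; lra.
    apply: le_trans (H s t sT tT (ltW stdl) (x, i) clx) _.
    by rewrite mulrC -ler_pdivlMr// ltW.
  + move=> x clx; apply/rowP => i; rewrite HU.
    by have := u_0 (x, i) clx; rewrite normr_le0 subr_eq0 => /eqP.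
  + move=> t x t0 clx.
    have lim : h^-1 *: (U (h *: (1 : R) + t) x - U t x) @[h --> 0^'] -->
        nonlocal_rhs Om d K g U t x.
      apply/cvgrPdist_le => e e0.
      have [dl dl0 H] := quotient t (ltW t0) e e0.
      near=> h.
      have E : h *: (1 : R) + t - t = h by rewrite addrK [_ *: _]mulr1.
      rewrite -{1}E; apply: H => //.
      * have : `|h| < t by near: h; exact: dnbhs0_lt.
        by rewrite ltr_norml [_ *: _]mulr1 => /andP[? _]; lra.
      * by rewrite -subr_eq0 E; near: h; exact: nbhs_dnbhs_neq.
      * by rewrite E; near: h; exact: dnbhs0_lt.
    apply: DeriveDef; first exact: (cvgP _ lim).
    exact: (cvg_lim (@norm_hausdorff _ _) lim).
- move=> t x t0 clx.
  apply: (cvgP (nonlocal_rhs Om d K g U t x)); apply/cvgrPdist_le => e e0.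
  have [dl dl0 H] := quotient t t0 e e0.
  rewrite near_withinE; near=> s => s0; apply: H => //.
    by near: s; exact: nbhs_dnbhs_neq.
  by near: s; apply: nbhs_dnbhs; exact: near_dist.
(* Uniqueness: [w] is a strict solution as well. *)
- move=> w [[Sw cw] w_0 dw] t x t0 clx; apply/rowP => i.
  pose W r := flat (w r); pose T := t + 1; have T0 : 0 < T by rewrite ltr_wpDl.
  have SW r : 0 <= r -> S (W r) by move=> r0; apply: Sflat; exact: Sw.
  have [L L0 lipT] := lip T; have [B bdT] := bd T.
  have bdT' : bounded_upto A S F T `|B|.
    by move=> r phi p rT Sphi Ap; rewrite (le_trans (bdT r phi p rT Sphi Ap))// ler_norm.
  have SuT r : 0 <= r <= T -> S (u r) by move=> /andP[r0 _]; exact: Su.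
  have SWT r : 0 <= r <= T -> S (W r) by move=> /andP[r0 _]; exact: SW.
  have cW p : A p -> {within [set r : R | 0 <= r], continuous (fun r => W r p)}.
    move=> Ap; apply/subspace_continuousP => r r0; apply/cvgrPdist_le => e e0.
    have /cvgrPdist_le/(_ e e0) := cw r r0.
    rewrite !near_withinE; apply: filterS => s Hs s0; have := Hs s0.
    rewrite sub0r normrN => /(le_trans (ler_norm _)); apply: le_trans.
    apply: le_trans (le_hatX_norm (Sw s s0) (Sw r r0) Ap).
    by rewrite distrC (le_trans _ (normr_coord_le _ p.2))// !mxE.
  have dW p (r : R) : A p -> 0 < r -> is_derive r 1 (fun s => W s p) (F r (W r) p).
    move=> Ap r0; have [dwr dwE] := dw r p.1 r0 Ap.
    apply: DeriveDef; first by have /derivable_mxP := dwr; apply.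
    rewrite /F /rhs_field /W flatK.
    have := congr1 (fun M : 'rV[R]_m => M 0 p.2) (derive_mx dwr).
    by rewrite mxE dwE => <-.
  have sW := classical_strict_sol L0 (normr_ge0 B) bdT' lipT (equi T) SWT cW dW.
  have W_0 : udist_le A 0 (W 0) (u 0).
    move=> [y j] cly; have := u_0 (y, j) cly; rewrite !normr_le0 !subr_eq0 => /eqP ->.
    by rewrite /W /flat w_0.
  have tT : 0 <= t <= T by rewrite t0 /T lerDl ler01.
  have := strict_sol_unique L0 lipT SWT SuT W_0 sW (su T T0) tT (x := (x, i)) clx.
  by rewrite HU normr_le0 subr_eq0 => /eqP.
Unshelve. all: by end_near. Qed.
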